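(* Consider the following signature $(2,2)$ conformal structures $[g]$ in coordinates $(x,y,u,v)$. (a) $\mathsf{M9}$: $g=dx\,du+dy\,dv+x^2dv^2$; (b) $\mathsf{M8}$, in its two real forms: $\mathsf{M8.1}$: $g=\frac{2}{(v+ux-y)^2}\left(u\,dv\,dx-dv\,dy-(v-y)\,du\,dx-x\,du\,dy\right)$, and $\mathsf{M8.2}$: $g=\frac{1}{(2u+x^2+y^2)^2}\left(du^2+dv^2-2y\,dv\,dx+2x\,dv\,dy+2x\,du\,dx+2y\,du\,dy-2u\,dx^2-2u\,dy^2\right)$ on $\{2u+x^2+y^2>0\}$; (c) $\mathsf{M7}$: for each $r\ge0$ and $\epsilon\in\{\pm1\}$, $g=9(2\epsilon r^2+4rx+y^2-1)du^2+12\epsilon(ry+2x)\,du\,dv-12\epsilon\,du\,dx+(12r^2-6y-10\epsilon)dv^2+6\,dv\,dy$; (d) $\mathsf{M6S}$: $g=\frac{dx^2+\epsilon\,dy^2}{(1+\kappa(x^2+\epsilon y^2))^2}-\frac{du^2+\epsilon\,dv^2}{(1+9\kappa(u^2+\epsilon v^2))^2}$ with $(\kappa,\epsilon)\in\{(1,-1),(-1,1),(1,1)\}$; (e) $\mathsf{M6N}$: $g=dy\,du+dx\,dv+2e^{2v}dx\,dy-2e^{2v}u\,dy^2-u\,dy\,dv$. Then the conformal structures in (a), (b), (c) admit Einstein representatives (on an open subset), whereas those in (d) and (e) do not (on any nonempty open subset).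
   Context: Products of $1$-forms are symmetric: $\alpha\beta=\frac12(\alpha\otimes\beta+\beta\otimes\alpha)$. Metrics are considered where defined. An Einstein representative of $[g]$ on an open set $U$ is a metric $\hat g=\sigma^{-2}g$ with $\sigma$ a nowhere-vanishing smooth function on $U$ such that the Ricci tensor of $\hat g$ is a constant multiple (possibly zero) of $\hat g$. *)

(* Defs.v *)
From HB Require Import structures.
From mathcomp Require Import all_boot all_order all_algebra.
From mathcomp Require Import all_classical all_reals all_analysis.
From mathcomp Require Import ring lra.

Set Implicit Arguments.
Unset Strict Implicit.
Unset Printing Implicit Defensive.

Import Order.TTheory GRing.Theory Num.Theory.
Import numFieldNormedType.Exports.

Local Open Scope classical_set_scope.
Local Open Scope ring_scope.

Section PseudoRiemannian.
Variable R : realType.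

Notation pt := 'rV[R]_4.

Definition pd (i : 'I_4) (f : pt -> R) : pt -> R :=
  fun p => 'D_(delta_mx 0 i) f p.

Fixpoint iter_pd (s : seq 'I_4) (f : pt -> R) : pt -> R :=
  if s is i :: s' then pd i (iter_pd s' f) else f.

(* Meant for open U: the values of f outside U are then irrelevant. *)
Definition smooth_on (U : set pt) (f : pt -> R) : Prop :=
  forall (s : seq 'I_4) (p : pt), U p ->
    {for p, continuous (iter_pd s f)} /\
    (forall i : 'I_4, derivable (iter_pd s f) p (delta_mx 0 i)).

Definition christoffel (g : pt -> 'M[R]_4) (k i j : 'I_4) (p : pt) : R :=
  2^-1 * \sum_(l < 4) invmx (g p) k l *
    (pd i (fun q => g q j l) p + pd j (fun q => g q i l) p
     - pd l (fun q => g q i j) p).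

Definition ricci (g : pt -> 'M[R]_4) (p : pt) : 'M[R]_4 :=
  \matrix_(i, j) \sum_(k < 4)
    (pd k (christoffel g k i j) p - pd j (christoffel g k i k) p
     + \sum_(l < 4) (christoffel g k k l p * christoffel g l i j p
                     - christoffel g k j l p * christoffel g l i k p)).

Definition einstein_on (U : set pt) (g : pt -> 'M[R]_4) : Prop :=
  exists lam : R, forall p, U p -> ricci g p = lam *: g p.

Definition rescale (sigma : pt -> R) (g : pt -> 'M[R]_4) : pt -> 'M[R]_4 :=
  fun p => (sigma p) ^- 2 *: g p.

(* A formula for g on R^4 together with the set where it is a metric; the
   signature lemmas at the end show that it is nondegenerate there. *)
Record local_metric := LocalMetric {
  domain : set pt;
  tensor : pt -> 'M[R]_4 }.

Definition einstein_representative
    (g : local_metric) (U : set pt) (sigma : pt -> R) : Prop :=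
  [/\ smooth_on U sigma,
      (forall p, U p -> sigma p != 0) &
      einstein_on U (rescale sigma (tensor g))].

Definition has_einstein_representative_on
    (g : local_metric) (U : set pt) : Prop :=
  exists sigma : pt -> R, einstein_representative g U sigma.

Definition admits_einstein_representative (g : local_metric) : Prop :=
  exists U : set pt,
    [/\ open U, U !=set0, U `<=` domain g &
        has_einstein_representative_on g U].

Definition nowhere_einstein_representative (g : local_metric) : Prop :=
  forall U : set pt, open U -> U !=set0 -> U `<=` domain g ->
    ~ has_einstein_representative_on g U.

(* The symmetric product (a (x) b + b (x) a) / 2 of two covectors. *)
Definition symprod (a b : 'rV[R]_4) : 'M[R]_4 :=
  2^-1 *: (a^T *m b + b^T *m a).

Definition signature22 (h : 'M[R]_4) : Prop :=
  exists a b c d : 'rV[R]_4,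
    (\matrix_(i < 4) [:: a; b; c; d]`_i) \in unitmx /\
    h = symprod a a + symprod b b - symprod c c - symprod d d.

End PseudoRiemannian.

Section Metrics.
Variable R : realType.

Notation pt := 'rV[R]_4.
Local Notation "a ** b" := (symprod a b) (at level 40).

Definition ix : 'I_4 := @Ordinal 4 0 isT.
Definition iy : 'I_4 := @Ordinal 4 1 isT.
Definition iu : 'I_4 := @Ordinal 4 2 isT.
Definition iv : 'I_4 := @Ordinal 4 3 isT.

Definition dx : 'rV[R]_4 := delta_mx 0 ix.
Definition dy : 'rV[R]_4 := delta_mx 0 iy.
Definition du : 'rV[R]_4 := delta_mx 0 iu.
Definition dv : 'rV[R]_4 := delta_mx 0 iv.

Definition M9 : local_metric R :=
  LocalMetric setT (fun p : pt =>
    let x := p 0 ix in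
    dx ** du + dy ** dv + x ^+ 2 *: (dv ** dv)).

Definition M8_1 : local_metric R :=
  LocalMetric
    [set p : pt | p 0 iv + p 0 iu * p 0 ix - p 0 iy != 0]
    (fun p : pt =>
    let x := p 0 ix in let y := p 0 iy in
    let u := p 0 iu in let v := p 0 iv in
    (2 / (v + u * x - y) ^+ 2) *:
      (u *: (dv ** dx) - dv ** dy - (v - y) *: (du ** dx) - x *: (du ** dy))).

Definition M8_2 : local_metric R :=
  LocalMetric
    [set p : pt | 0 < 2 * p 0 iu + p 0 ix ^+ 2 + p 0 iy ^+ 2]
    (fun p : pt =>
    let x := p 0 ix in let y := p 0 iy in let u := p 0 iu in
    (1 / (2 * u + x ^+ 2 + y ^+ 2) ^+ 2) *:
      (du ** du + dv ** dv - (2 * y) *: (dv ** dx) + (2 * x) *: (dv ** dy)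
       + (2 * x) *: (du ** dx) + (2 * y) *: (du ** dy)
       - (2 * u) *: (dx ** dx) - (2 * u) *: (dy ** dy))).

Definition M7 (r eps : R) : local_metric R :=
  LocalMetric setT (fun p : pt =>
    let x := p 0 ix in let y := p 0 iy in
    (9 * (2 * eps * r ^+ 2 + 4 * r * x + y ^+ 2 - 1)) *: (du ** du)
    + (12 * eps * (r * y + 2 * x)) *: (du ** dv)
    - (12 * eps) *: (du ** dx)
    + (12 * r ^+ 2 - 6 * y - 10 * eps) *: (dv ** dv)
    + 6 *: (dv ** dy)).

Definition M6S (kappa eps : R) : local_metric R :=
  LocalMetric
    [set p : pt |
       1 + kappa * (p 0 ix ^+ 2 + eps * p 0 iy ^+ 2) != 0 /\
       1 + 9 * kappa * (p 0 iu ^+ 2 + eps * p 0 iv ^+ 2) != 0]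
    (fun p : pt =>
    let x := p 0 ix in let y := p 0 iy in
    let u := p 0 iu in let v := p 0 iv in
    (1 / (1 + kappa * (x ^+ 2 + eps * y ^+ 2)) ^+ 2) *:
      (dx ** dx + eps *: (dy ** dy))
    - (1 / (1 + 9 * kappa * (u ^+ 2 + eps * v ^+ 2)) ^+ 2) *:
      (du ** du + eps *: (dv ** dv))).

Definition M6N : local_metric R :=
  LocalMetric setT (fun p : pt =>
    let u := p 0 iu in let v := p 0 iv in
    dy ** du + dx ** dv + (2 * expR (2 * v)) *: (dx ** dy)
    - (2 * expR (2 * v) * u) *: (dy ** dy) - u *: (dy ** dv)).

End Metrics.

Section Signature.
Variable R : realType.

Notation pt := 'rV[R]_4.
Local Notation "a ** b" := (symprod a b) (at level 40).
Local Notation dx := (dx R).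
Local Notation dy := (dy R).
Local Notation du := (du R).
Local Notation dv := (dv R).

Lemma symprodE (a b : 'rV[R]_4) i j :
  (a ** b) i j = 2^-1 * (a 0 i * b 0 j + b 0 i * a 0 j).
Proof. by rewrite !mxE !big_ord1 !mxE. Qed.

Lemma symprod_sym (a b : 'rV[R]_4) : (a ** b)^T = a ** b.
Proof. by apply/matrixP => i j; rewrite mxE !symprodE; ring. Qed.

Definition pairing (a : 'rV[R]_4) (w : 'I_4 -> R) : R :=
  a 0 ix * w ix + a 0 iy * w iy + a 0 iu * w iu + a 0 iv * w iv.

Definition independent4 (a b c d : 'rV[R]_4) : Prop :=
  forall w, pairing a w = 0 -> pairing b w = 0 -> pairing c w = 0 ->
    pairing d w = 0 -> [/\ w ix = 0, w iy = 0, w iu = 0 & w iv = 0].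

Lemma independent4_unitmx (a b c d : 'rV[R]_4) :
  independent4 a b c d -> (\matrix_(i < 4) [:: a; b; c; d]`_i) \in unitmx.
Proof.
move=> ind; set M := \matrix_i _.
rewrite -unitmx_tr -row_free_unit; apply/row_freeP.
exists (pinvmx M^T); apply/mulmxVp; rewrite -kermx_eq0.
apply/rowV0P => w /sub_kermxP wM.
have E (i : 'I_4) : pairing (nth 0 [:: a; b; c; d] i) (w 0) = 0.
  have := congr1 (fun m : 'rV[R]_4 => m 0 i) wM.
  rewrite !mxE !big_ord_recl big_ord0 !mxE /pairing => <-.
  have -> : ord0 = ix by exact: val_inj.
  have -> : lift ix ord0 = iy by exact: val_inj.
  have -> : lift ix (lift ord0 ord0) = iu by exact: val_inj.
  have -> : lift ix (lift ord0 (lift ord0 ord0)) = iv by exact: val_inj.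
  by ring.
have [wx wy wu wv] := ind (w 0) (E ix) (E iy) (E iu) (E iv).
apply/rowP => -[[|[|[|[|//]]]] lti]; rewrite mxE.
- by rewrite -[RHS]wx; congr (w 0 _); exact: val_inj.
- by rewrite -[RHS]wy; congr (w 0 _); exact: val_inj.
- by rewrite -[RHS]wu; congr (w 0 _); exact: val_inj.
- by rewrite -[RHS]wv; congr (w 0 _); exact: val_inj.
Qed.

Lemma signature22_diag (a b c d : 'rV[R]_4) (h : 'M[R]_4) :
  independent4 a b c d -> h = a ** a + b ** b - c ** c - d ** d ->
  signature22 h.
Proof. by move=> /independent4_unitmx ?; exists a, b, c, d. Qed.

Lemma signature22_null (a b c d : 'rV[R]_4) (h : 'M[R]_4) :
  independent4 a b c d -> h = a ** b + c ** d -> signature22 h.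
Proof.
move=> ind ->.
apply: (@signature22_diag (2^-1 *: (a + b)) (2^-1 *: (c + d))
                          (2^-1 *: (a - b)) (2^-1 *: (c - d))).
  move=> w; rewrite /pairing !mxE => e1 e2 e3 e4.
  by apply: ind; rewrite /pairing; lra.
by apply/matrixP => i j; rewrite !(symprodE, mxE) /=; field.
Qed.

Let cE := (symprodE, mxE).
Let ordE := ((erefl : (ix == ix) = true), (erefl : (iy == iy) = true),
  (erefl : (iu == iu) = true), (erefl : (iv == iv) = true),
  (erefl : (ix == iy) = false), (erefl : (ix == iu) = false),
  (erefl : (ix == iv) = false), (erefl : (iy == ix) = false),
  (erefl : (iy == iu) = false), (erefl : (iy == iv) = false),
  (erefl : (iu == ix) = false), (erefl : (iu == iy) = false),
  (erefl : (iu == iv) = false), (erefl : (iv == ix) = false),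
  (erefl : (iv == iy) = false), (erefl : (iv == iu) = false)).

Lemma M9_signature (p : pt) : signature22 (tensor (M9 R) p).
Proof.
apply: (@signature22_null dx du dv (dy + (p 0 ix) ^+ 2 *: dv)).
  move=> w; rewrite /pairing !mxE !eqxx !ordE /= => *.
  by split; nra.
by apply/matrixP => i j; rewrite /= !cE /=; ring.
Qed.

Lemma M8_1_signature (p : pt) :
  domain (M8_1 R) p -> signature22 (tensor (M8_1 R) p).
Proof.
rewrite /=; set x := p 0 ix; set y := p 0 iy; set u := p 0 iu.
set v := p 0 iv; move=> D0.
pose f := 2 / (v + u * x - y) ^+ 2.
have f0 : f != 0 by rewrite mulf_neq0 ?invr_eq0 ?expf_neq0 ?pnatr_eq0.
apply: (@signature22_null (f *: dv) (u *: dx - dy)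
                          (f *: du) (- (v - y) *: dx - x *: dy)).
  move=> w; rewrite /pairing !mxE !eqxx !ordE /= => e1 e2 e3 e4.
  have wv : w iv = 0 by apply: (mulfI f0); rewrite mulr0 -[RHS]e1; ring.
  have wu : w iu = 0 by apply: (mulfI f0); rewrite mulr0 -[RHS]e3; ring.
  have wy : w iy = u * w ix by lra.
  have wx : w ix = 0.
    by apply: (mulfI D0); rewrite mulr0 -[RHS]oppr0 -e4 wy; ring.
  by rewrite wy wx mulr0; split.
by apply/matrixP => i j; rewrite !cE -/f /=; ring.
Qed.

Lemma M8_2_signature (p : pt) :
  domain (M8_2 R) p -> signature22 (tensor (M8_2 R) p).
Proof.
rewrite /=; set x := p 0 ix; set y := p 0 iy; set u := p 0 iu.
set D := 2 * u + x ^+ 2 + y ^+ 2 => D0.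
have DN0 : D != 0 by rewrite gt_eqF.
pose s := Num.sqrt D.
have ss : s ^+ 2 = D by rewrite sqr_sqrtr ?ltW.
have s0 : s != 0 by rewrite gt_eqF ?sqrtr_gt0.
apply: (@signature22_diag (D^-1 *: (du + x *: dx + y *: dy))
   (D^-1 *: (dv - y *: dx + x *: dy)) ((D^-1 * s) *: dx) ((D^-1 * s) *: dy)).
  move=> w; rewrite /pairing !mxE !eqxx !ordE /= => e1 e2 e3 e4.
  have I0 : D^-1 != 0 by rewrite invr_eq0.
  have J0 : D^-1 * s != 0 by rewrite mulf_neq0.
  have wx : w ix = 0 by apply: (mulfI J0); rewrite mulr0 -[RHS]e3; ring.
  have wy : w iy = 0 by apply: (mulfI J0); rewrite mulr0 -[RHS]e4; ring.
  have wu : w iu = 0 by apply: (mulfI I0); rewrite mulr0 -[RHS]e1 wx wy; ring.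
  have wv : w iv = 0 by apply: (mulfI I0); rewrite mulr0 -[RHS]e2 wx wy; ring.
  by split.
have uE : u = 2^-1 * (s ^+ 2 - x ^+ 2 - y ^+ 2) by rewrite ss /D; field.
apply/matrixP => i j; rewrite !cE -ss uE /=.
by field.
Qed.

Lemma M7_signature (r eps : R) (p : pt) :
  eps = 1 \/ eps = -1 -> signature22 (tensor (M7 r eps) p).
Proof.
move=> epsE /=; set x := p 0 ix; set y := p 0 iy.
apply: (@signature22_null du
   ((9 * (2 * eps * r ^+ 2 + 4 * r * x + y ^+ 2 - 1)) *: du
    + (12 * eps * (r * y + 2 * x)) *: dv - (12 * eps) *: dx)
   dv ((12 * r ^+ 2 - 6 * y - 10 * eps) *: dv + 6 *: dy)).
  move=> w; rewrite /pairing !mxE !eqxx !ordE /= => e1 e2 e3 e4.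
  have wv : w iv = 0 by lra.
  have wu : w iu = 0 by lra.
  have wy : w iy = 0 by rewrite wv in e4; lra.
  rewrite wv wu wy in e2; split=> //.
  by case: epsE e2 => ->; lra.
by apply/matrixP => i j; rewrite !cE /=; ring.
Qed.

Lemma M6S_signature (kappa eps : R) (p : pt) :
  eps = 1 \/ eps = -1 -> domain (M6S kappa eps) p ->
  signature22 (tensor (M6S kappa eps) p).
Proof.
move=> epsE /=; set D := 1 + kappa * _; set E := 1 + 9 * kappa * _.
move=> [D0 E0].
have DV0 : D^-1 != 0 by rewrite invr_eq0.
have EV0 : E^-1 != 0 by rewrite invr_eq0.
have ind : independent4 (D^-1 *: dx) (D^-1 *: dy) (E^-1 *: du) (E^-1 *: dv).
  move=> w; rewrite /pairing !mxE !eqxx !ordE /= => e1 e2 e3 e4; split.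
  - by apply: (mulfI DV0); rewrite mulr0 -[RHS]e1; ring.
  - by apply: (mulfI DV0); rewrite mulr0 -[RHS]e2; ring.
  - by apply: (mulfI EV0); rewrite mulr0 -[RHS]e3; ring.
  - by apply: (mulfI EV0); rewrite mulr0 -[RHS]e4; ring.
move: D E D0 E0 DV0 EV0 ind => D E D0 E0 DV0 EV0 ind.
case: epsE => ->; [apply: signature22_diag ind _
  | apply: (@signature22_diag (D^-1 *: dx) (E^-1 *: dv)
                              (D^-1 *: dy) (E^-1 *: du))].
- by apply/matrixP => i j; rewrite !cE /=; field; rewrite D0 E0.
- by move=> w e1 e2 e3 e4; exact: ind.
- by apply/matrixP => i j; rewrite !cE /=; field; rewrite D0 E0.
Qed.

Lemma M6N_signature (p : pt) : signature22 (tensor (M6N R) p).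
Proof.
rewrite /=; set u := p 0 iu; set e := expR _.
apply: (@signature22_null dx (dv + (2 * e) *: dy)
   dy (du - (2 * e * u) *: dy - u *: dv)).
  move=> w; rewrite /pairing !mxE !eqxx !ordE /= => e1 e2 e3 e4.
  have wx : w ix = 0 by lra.
  have wy : w iy = 0 by lra.
  have wv : w iv = 0 by rewrite wx wy in e2; lra.
  by rewrite wx wy wv in e4; split=> //; lra.
by apply/matrixP => i j; rewrite !cE /=; ring.
Qed.

End Signature.

(* Main.v *)
Require Import Defs.
From mathcomp Require Import all_boot all_order all_algebra.
From mathcomp Require Import all_classical all_reals all_analysis.
From mathcomp Require Import ring lra.
Import Order.TTheory GRing.Theory Num.Theory.
Import numFieldNormedType.Exports.

(** For a metric [g] in dimension 4 and [h = s^-2 g],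

      [Ric(h) = Ric(g) + (2/s) Hess(s) + (Lap(s)/s - 3 |ds|^2/s^2) g]

    (lemma [ricci_rescale]), so a nowhere-vanishing [s] is an Einstein scale
    only if [Hess(s) + (s/2) Ric(g) = phi g] for some function [phi]
    (lemma [einstein_hessian]).  This is a linear overdetermined system for
    [s], and both halves of the theorem are about its solutions.

    - M9 and the two forms of M8 are Einstein as they stand, with Einstein
      constants 0, -3 and -6, so [s = 1] works.
    - For M7 the ansatz [s = exp(v) A(u)] reduces the system to the equation
      [A'' - 3 r eps A' + (2 r^2 - 5 eps) A = 0], which has constant
      coefficients; the resulting metric is Ricci-flat.  The characteristic
      roots may be complex, in which case [A] is an exponential times a cosine
      and the open set avoids the zeros of the cosine.
    - M6S is a difference [g1 - g2] of surface metrics of curvatures [4 kappa]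
      and [36 kappa].  The mixed components of the system say that [ds]
      splits; on each factor [Hess(s)] is a multiple [psi] of the surface
      metric, and commuting third derivatives gives [d psi = -K ds], with [K]
      the curvature of the factor.  Comparing this with the trace part of the
      system, in which the two curvatures enter together, forces [ds = 0] on
      both factors ([block_gradient]), and a constant [s] must vanish because
      [g1 - g2] is not Einstein.
    - For M6N, cross-differentiating the equations of the system kills [s_u],
      then [s_x], then [s_v + s/2], then [s_y], and finally [s] itself
      ([M6N_nowhere]).

    Exchanging the order of derivatives rests on Schwarz's theorem
    ([schwarz]).  The Ricci tensors of the six families are computed formally:
    a coordinate expression is an element of an inductive type [term], with a
    formal derivative proved correct in [eval_regular]; besides the
    coordinates a term may mention the partial derivatives of the unknown
    scale.  Christoffel symbols are not computed from the inverse metric.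
    They are given by tables and recognised by the characterisation of the
    Levi-Civita connection as the torsion-free metric connection
    ([christoffel_levi_civita]); each verification is then a polynomial or
    rational identity. *)

Set Implicit Arguments.
Unset Strict Implicit.
Unset Printing Implicit Defensive.
Local Open Scope classical_set_scope.
Local Open Scope ring_scope.

(** * Directional derivatives *)

Section DirectionalChainRule.
Variables (R : realType) (V : normedModType R).

(** Reduces directional derivatives to derivatives of functions of one real
    variable, for which a chain rule is available. *)
Lemma derive_along_line (W : normedModType R) (f : V -> W) (p v : V) :
  'D_v f p = 'D_1 (fun h : R => f (h *: v + p)) 0.
Proof.
rewrite /derive; set u := (u in lim (u @ _)); set w := (u in _ = lim (u @ _)).
suff -> : u = w by [].
by apply/funext => h; rewrite /u /w /= addr0 scale0r add0r [_%:A]mulr1.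
Qed.

Lemma is_derive_along_line (W : normedModType R) (f : V -> W) (p v : V) (df : W) :
  is_derive (0 : R) 1 (fun h : R => f (h *: v + p)) df <-> is_derive p v f df.
Proof.
split=> -[fv fE]; apply: DeriveDef.
- exact/derivable1P.
- by rewrite derive_along_line.
- by move/derivable1P: fv.
- by rewrite -derive_along_line.
Qed.

Lemma is_derive_comp_dir (phi : R -> R) (f : V -> R) (p v : V) (df dphi : R) :
  is_derive p v f df -> is_derive (f p) 1 phi dphi ->
  is_derive p v (phi \o f) (dphi * df).
Proof.
move=> /is_derive_along_line; set l := fun h : R => _ => -[l1 lE] dphi1.
have l0 : l 0 = f p by rewrite /l scale0r add0r.
rewrite -l0 in dphi1; case: dphi1 => phi1 phiE.
apply/is_derive_along_line; rewrite -[X in is_derive _ _ X]/(phi \o l).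
have phil : derivable (phi \o l) 0 1.
  apply/derivable1_diffP.
  apply: (@differentiable_comp _ _ _ _ l phi); apply/derivable1_diffP;
    [exact: l1|exact: phi1].
apply: DeriveDef; first exact: phil.
rewrite -derive1E derive1_comp; [|exact: l1|exact: phi1].
by rewrite !derive1E phiE lE.
Qed.

Lemma is_deriveV_dir (f : V -> R) (p v : V) (df : R) :
  f p != 0 -> is_derive p v f df ->
  is_derive p v (fun q => (f q)^-1) (- (df * ((f p)^-1 * (f p)^-1))).
Proof.
move=> f0 [fv <-]; apply: DeriveDef; first exact: derivableV.
by rewrite deriveV // /GRing.scale /= expr2 invfM; ring.
Qed.

End DirectionalChainRule.

(** * Symmetry of second partial derivatives *)

Section Schwarz.
Variable R : realType.
Local Notation pt := 'rV[R]_4.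
Implicit Types (U : set pt) (f : pt -> R) (p : pt).

Definition coordv (i : 'I_4) : pt := delta_mx 0 i.

Lemma derive_line f p (w v : pt) (t : R) :
  derivable f (p + t *: v + w) v ->
  is_derive t 1 (fun s => f (p + s *: v + w)) ('D_v f (p + t *: v + w)).
Proof.
move=> fv; set q := p + t *: v + w.
have E : (fun s => f (p + s *: v + w)) =
         (fun h : R => f (h *: v + q)) \o (fun s => s - t).
  apply/funext => s /=; congr f; rewrite /q scalerBl.
  by apply/rowP => i; rewrite !mxE; ring.
rewrite E.
have D1 : is_derive ((fun s : R => s - t) t) (1 : R)
   (fun h : R => f (h *: v + q)) ('D_v f q).
  rewrite subrr; exact/is_derive_along_line/derivableP.
have D0 : is_derive t (1 : R) (fun s : R => s - t) 1.
  by apply: is_derive_eq; rewrite subr0.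
have := @is_derive_comp_dir _ _ _ (fun s : R => s - t) t 1 1 _ D0 D1.
by rewrite mulr1.
Qed.

Lemma derive_line0 f p (v : pt) (t : R) :
  derivable f (p + t *: v) v ->
  is_derive t 1 (fun s => f (p + s *: v)) ('D_v f (p + t *: v)).
Proof.
move=> fv; have := @derive_line f p 0 v t; rewrite addr0 => /(_ fv).
suff <- : (fun s : R => f (p + s *: v + 0)) = (fun s => f (p + s *: v)) by [].
by apply/funext => s; rewrite addr0.
Qed.

(** Two applications of the mean value theorem, first in the direction [v] to
    the increment of [f] along [w], then in the direction [w].  The left-hand
    side is symmetric in [v] and [w]; this is what makes [schwarz] work. *)
Lemma second_difference U f p (v w : pt) (h : R) : 0 < h ->
  (forall s t, 0 <= s <= h -> 0 <= t <= h -> U (p + s *: v + t *: w)) ->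
  (forall q, U q -> derivable f q v /\ derivable ('D_v f) q w) ->
  exists s t, [/\ 0 <= s <= h, 0 <= t <= h &
    f (p + h *: v + h *: w) - f (p + h *: v) - (f (p + h *: w) - f p)
    = 'D_w ('D_v f) (p + s *: v + t *: w) * h * h].
Proof.
move=> h0 inU df.
have hh : 0 <= h <= h by rewrite ltW /=.
have zh : 0 <= (0 : R) <= h by rewrite lexx ltW.
pose F s := f (p + s *: v + h *: w) - f (p + s *: v).
pose dF s := 'D_v f (p + s *: v + h *: w) - 'D_v f (p + s *: v).
have dFE s : 0 <= s <= h -> is_derive s 1 F (dF s).
  move=> sh; apply: is_deriveB.
    by apply: derive_line; exact: (df _ (inU _ _ sh hh)).1.
  apply: derive_line0.
  have := inU _ _ sh zh; rewrite scale0r addr0 => Us; exact: (df _ Us).1.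
have Fc : {within `[0, h], continuous F}.
  apply: derivable_within_continuous => s; rewrite in_itv /= => sh.
  by case: (dFE s sh).
have [s /itvP sI Es] := MVT_segment (ltW h0)
  (fun s sI => dFE s (ltac:(by rewrite !(itvP sI)))) Fc.
have sh : 0 <= s <= h by rewrite !sI.
pose G t := 'D_v f (p + s *: v + t *: w).
have dGE t : 0 <= t <= h -> is_derive t 1 G ('D_w ('D_v f) (p + s *: v + t *: w)).
  move=> th; apply: derive_line0.
  exact: (df _ (inU _ _ sh th)).2.
have Gc : {within `[0, h], continuous G}.
  apply: derivable_within_continuous => t; rewrite in_itv /= => th.
  by case: (dGE t th).
have [t /itvP tI Et] := MVT_segment (ltW h0)
  (fun t tI => dGE t (ltac:(by rewrite !(itvP tI)))) Gc.
exists s, t; split; rewrite ?tI ?sI //.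
move: Es Et; rewrite /F /G /dF !scale0r !addr0 !subr0 => -> ->.
by [].
Qed.

(** If the two mixed derivatives differed at [p], continuity would keep them
    apart on a small parallelogram, where both equal the same second
    difference. *)
Lemma schwarz U f p (v w : pt) : open U -> U p ->
  (forall q, U q -> [/\ derivable f q v, derivable f q w,
     derivable ('D_v f) q w & derivable ('D_w f) q v]) ->
  {for p, continuous ('D_w ('D_v f))} -> {for p, continuous ('D_v ('D_w f))} ->
  'D_w ('D_v f) p = 'D_v ('D_w f) p.
Proof.
move=> oU Up df cwv cvw; apply/eqP; rewrite -subr_eq0; apply: contraT.
set a := 'D_w _ p; set b := 'D_v _ p => ab.
have d0 : 0 < `|a - b| / 2 by rewrite divr_gt0 // normr_gt0.
pose B := U `&` ([set q | `|a - 'D_w ('D_v f) q| < `|a - b| / 2] `&`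
                 [set q | `|b - 'D_v ('D_w f) q| < `|a - b| / 2]).
have nB : nbhs p B.
  apply: filterI; first exact: open_nbhs_nbhs.
  apply: filterI.
    by have /cvgr_dist_lt /(_ _ d0) := cwv.
  by have /cvgr_dist_lt /(_ _ d0) := cvw.
have [_/posnumP[e] eB] := (iffLR (nbhs_ballP _ _) nB).
(* Small enough for the parallelogram spanned by h v and h w to fit in the
   ball; the 1 avoids a division by zero. *)
pose h := e%:num / (`|v| + `|w| + 1).
have N0 : 0 < `|v| + `|w| + 1 by rewrite ltr_wpDl // addr_ge0.
have h0 : 0 < h by rewrite divr_gt0.
have inB s t : 0 <= s <= h -> 0 <= t <= h -> B (p + s *: v + t *: w).
  move=> /andP[s0 sh] /andP[t0 th]; apply: eB.
  rewrite -ball_normE /ball_ /= -addrA opprD addrA subrr sub0r normrN.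
  apply: (le_lt_trans (ler_normD _ _)); rewrite !normrZ !ger0_norm //.
  apply: (@le_lt_trans _ _ (h * (`|v| + `|w|))).
    by rewrite mulrDr lerD // ler_wpM2r.
  by rewrite /h mulrAC ltr_pdivrMr // ltr_pM2l // ltrDl.
have inB' s t : 0 <= s <= h -> 0 <= t <= h -> B (p + s *: w + t *: v).
  by move=> sh th; rewrite addrAC; exact: inB.
have dB1 q : B q -> derivable f q v /\ derivable ('D_v f) q w.
  by case=> /df [].
have dB2 q : B q -> derivable f q w /\ derivable ('D_w f) q v.
  by case=> /df [].
have [s [t [sh th E1]]] := second_difference h0 inB dB1.
have [s' [t' [sh' th' E2]]] := second_difference h0 inB' dB2.
have [_ [/= B1 _]] := inB _ _ sh th.
have [_ [_ /= B2]] := inB' _ _ sh' th'.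
have E : 'D_w ('D_v f) (p + s *: v + t *: w) = 'D_v ('D_w f) (p + s' *: w + t' *: v).
  apply: (mulIf (lt0r_neq0 h0)); apply: (mulIf (lt0r_neq0 h0)).
  have swap (k l m n : R) : k - l - (m - n) = k - m - (l - n) by ring.
  by apply: etrans (esym E1) (etrans _ E2); rewrite (addrAC p (h *: w)); exact: swap.
rewrite -E in B2.
suff midpoint (x y z : R) :
    `|x - z| < `|x - y| / 2 -> `|y - z| < `|x - y| / 2 -> False.
  by case: (midpoint _ _ _ B1 B2).
move=> xz yz; have : `|x - y| < `|x - y| / 2 + `|x - y| / 2.
  have {1}-> : x - y = (x - z) - (y - z) by ring.
  by apply: (le_lt_trans (ler_normB _ _)); rewrite ltrD.
by rewrite -splitr ltxx.
Qed.

Lemma pdC U f p (i j : 'I_4) : open U -> smooth_on U f -> U p ->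
  pd i (pd j f) p = pd j (pd i f) p.
Proof.
move=> oU sf Up; apply: (@schwarz U) => //.
- move=> q Uq; have [_ d0] := sf [::] q Uq.
  have [_ di] := sf [:: i] q Uq; have [_ dj] := sf [:: j] q Uq.
  by split; [exact: d0|exact: d0|exact: dj|exact: di].
- by have [] := sf [:: i; j] p Up.
- by have [] := sf [:: j; i] p Up.
Qed.

End Schwarz.

(** * The conformal change of the Ricci tensor *)

(** The part of the computation that takes place at one point, with the
    derivatives of all quantities replaced by independent numbers: [G] stands
    for the Christoffel symbols of [g], [w] for [d log s], [W] for its
    gradient, and [C] for the difference of the two connections.  The
    derivative [dg] of the metric is expressed through [G]. *)
Section ConformalAlgebra.
Variable R : realType.
Variables (g : 'I_4 -> 'I_4 -> R) (G : 'I_4 -> 'I_4 -> 'I_4 -> R).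
Variables (dG : 'I_4 -> 'I_4 -> 'I_4 -> 'I_4 -> R).
Variables (w W : 'I_4 -> R) (dw dW : 'I_4 -> 'I_4 -> R).

Let dg m i j := \sum_(l < 4) (g i l * G l m j + g j l * G l m i).

Hypothesis gC : forall i j, g i j = g j i.
Hypothesis GC : forall k i j, G k i j = G k j i.
Hypothesis dwC : forall i j, dw i j = dw j i.
Hypothesis gW : forall i, \sum_(k < 4) g i k * W k = w i.
Hypothesis dgW : forall j i,
  \sum_(k < 4) (dg j i k * W k + g i k * dW j k) = dw j i.

Let delta (k i : 'I_4) : R := (k == i)%:R.
Let C k i j := delta k i * w j + delta k j * w i - g i j * W k.
Let dC m k i j :=
  delta k i * dw m j + delta k j * dw m i - (dg m i j * W k + g i j * dW m k).
Let w2 := \sum_(k < 4) w k * W k.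

Let sum_delta i (F : 'I_4 -> R) : \sum_(k < 4) delta k i * F k = F i.
Proof.
rewrite (bigD1 i) //= /delta eqxx mul1r big1 ?addr0 // => k /negPf ->.
by rewrite mul0r.
Qed.

Let sum_deltar i (F : 'I_4 -> R) : \sum_(k < 4) F k * delta k i = F i.
Proof. by under eq_bigr do rewrite mulrC; exact: sum_delta. Qed.

Let deltaC i j : delta i j = delta j i.
Proof. by rewrite /delta eq_sym. Qed.

Let sum_one (c : R) : \sum_(k < 4) c = 4 * c.
Proof. by rewrite sumr_const card_ord mulr_natl. Qed.

(** The factor 4 is the dimension. *)
Let trace_C i : \sum_(k < 4) C k k i = 4 * w i.
Proof.
rewrite /C sumrB big_split /=.
under eq_bigr do rewrite /delta eqxx mul1r.
rewrite sum_one sum_delta.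
by under [X in _ - X]eq_bigr do rewrite gC; rewrite gW; ring.
Qed.

Lemma sum_conformal i j (F : 'I_4 -> R) :
  \sum_(l < 4)
    F l * ((l == i)%:R * w j + (l == j)%:R * w i - g i j * W l)
  = F i * w j + F j * w i - g i j * \sum_(l < 4) F l * W l.
Proof.
rewrite mulr_sumr -[F i](sum_deltar i) -[F j](sum_deltar j) !mulr_suml.
by rewrite -big_split -sumrB /=; apply: eq_bigr => l _; rewrite /delta; ring.
Qed.

Let sum_CC i (F : 'I_4 -> 'I_4 -> R) :
  \sum_(k < 4) \sum_(l < 4) F k l * C l i k
  = \sum_(k < 4) F k i * w k + w i * \sum_(k < 4) F k k
    - \sum_(k < 4) g i k * \sum_(l < 4) F k l * W l.
Proof.
rewrite mulr_sumr -big_split -sumrB /=; apply: eq_bigr => k _.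
by rewrite /C sum_conformal; ring.
Qed.

(** Metric compatibility, contracted with the gradient. *)
Let gG_W i j : \sum_(k < 4) g i k * (\sum_(l < 4) G k j l * W l)
  + \sum_(k < 4) g j k * (\sum_(l < 4) G k i l * W l)
  = \sum_(k < 4) dg k i j * W k.
Proof.
under eq_bigr do rewrite mulr_sumr.
under [X in _ + X]eq_bigr do rewrite mulr_sumr.
rewrite exchange_big [X in _ + X]exchange_big -big_split /=.
apply: eq_bigr => k _; rewrite /dg mulr_suml -big_split /=.
by apply: eq_bigr => l _; rewrite (GC l k j) (GC l k i); ring.
Qed.

Let trace_C2 i j : \sum_(k < 4) \sum_(l < 4) C k j l * C l i k
  = 6 * (w i * w j) - 2 * (g i j * w2).
Proof.
rewrite sum_CC.
have -> : \sum_(k < 4) C k j k = 4 * w j.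
  by rewrite -trace_C; apply: eq_bigr => k _; rewrite /C gC; ring.
have -> : \sum_(k < 4) C k j i * w k = 2 * (w i * w j) - g i j * w2.
  under eq_bigr do rewrite mulrC.
  by rewrite /C sum_conformal gC -/w2; ring.
have E k : \sum_(l < 4) C k j l * W l = delta k j * w2.
  have -> : \sum_(l < 4) C k j l * W l =
     delta k j * \sum_(l < 4) w l * W l + w j * \sum_(l < 4) delta l k * W l
     - W k * \sum_(l < 4) g j l * W l.
    rewrite !mulr_sumr -big_split -sumrB /=; apply: eq_bigr => l _.
    by rewrite /C (deltaC k l); ring.
  by rewrite sum_delta gW -/w2; ring.
have -> : \sum_(k < 4) g i k * (\sum_(l < 4) C k j l * W l) = g i j * w2.
  under eq_bigr do rewrite E mulrA.
  by rewrite -mulr_suml sum_deltar.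
ring.
Qed.

(** The terms in [dg] produced by differentiating [g i j * W k] cancel against
    those coming from the products [G * C]. *)
Lemma conformal_ricci_algebra i j :
  \sum_(k < 4) ((dG k k i j - dC k k i j) - (dG j k i k - dC j k i k)
    + \sum_(l < 4) ((G k k l - C k k l) * (G l i j - C l i j)
                    - (G k j l - C k j l) * (G l i k - C l i k)))
  = \sum_(k < 4) (dG k k i j - dG j k i k
      + \sum_(l < 4) (G k k l * G l i j - G k j l * G l i k))
    + 2 * (dw i j + w i * w j - \sum_(k < 4) G k i j * w k)
    + (\sum_(k < 4) (dW k k + \sum_(l < 4) G l l k * W k)
       - 2 * \sum_(k < 4) w k * W k) * g i j.
Proof.
pose t l := \sum_(k < 4) G k k l.
(* d1, d2: the derivative terms; q1, q2: the quadratic terms. *)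
have d1 : \sum_(k < 4) dC k k i j
    = 2 * dw i j - \sum_(k < 4) dg k i j * W k - g i j * \sum_(k < 4) dW k k.
  rewrite /dC sumrB !big_split /= !sum_delta -mulr_sumr (dwC j i); ring.
have d2 : \sum_(k < 4) dC j k i k = 4 * dw i j.
  rewrite /dC sumrB dgW big_split /= sum_delta.
  under [X in _ + X - _]eq_bigr do rewrite /delta eqxx mul1r.
  by rewrite sum_one (dwC j i); ring.
have q1 : \sum_(k < 4) \sum_(l < 4) (G k k l - C k k l) * (G l i j - C l i j)
    = \sum_(k < 4) \sum_(l < 4) G k k l * G l i j
      - 4 * \sum_(k < 4) G k i j * w k - t i * w j - t j * w i + 8 * (w i * w j)
      + g i j * (\sum_(k < 4) t k * W k - 4 * w2).
  rewrite exchange_big /=.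
  under eq_bigr do rewrite -mulr_suml sumrB trace_C -/(t _) mulrBr.
  rewrite sumrB /C sum_conformal exchange_big /=.
  under [X in _ = X - _ - _ - _ + _ + _]eq_bigr do rewrite -mulr_suml -/(t _).
  rewrite /w2 !mulrBr !mulr_sumr.
  under [X in X - _ = _]eq_bigr do rewrite mulrBl.
  under [X in _ - (_ - X) = _]eq_bigr do rewrite mulrBl mulrBr.
  rewrite !sumrB /=.
  have -> : \sum_(k < 4) 4 * w k * G k i j = \sum_(k < 4) 4 * (G k i j * w k).
    by apply: eq_bigr => k _; ring.
  have -> : \sum_(k < 4) g i j * (4 * w k * W k) = \sum_(k < 4) g i j * (4 * (w k * W k)).
    by apply: eq_bigr => k _; ring.
  ring.
have q2 : \sum_(k < 4) \sum_(l < 4) (G k j l - C k j l) * (G l i k - C l i k)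
    = \sum_(k < 4) \sum_(l < 4) G k j l * G l i k
      - 2 * \sum_(k < 4) G k i j * w k - t i * w j - t j * w i + 6 * (w i * w j)
      - 2 * (g i j * w2) + \sum_(k < 4) dg k i j * W k.
  have -> : \sum_(k < 4) \sum_(l < 4) (G k j l - C k j l) * (G l i k - C l i k)
    = \sum_(k < 4) \sum_(l < 4) G k j l * G l i k
      - \sum_(k < 4) \sum_(l < 4) G k j l * C l i k
      - \sum_(k < 4) \sum_(l < 4) C k j l * G l i k
      + \sum_(k < 4) \sum_(l < 4) C k j l * C l i k.
    rewrite -!sumrB -big_split /=; apply: eq_bigr => k _.
    by rewrite -!sumrB -big_split /=; apply: eq_bigr => l _; ring.
  have -> : \sum_(k < 4) \sum_(l < 4) C k j l * G l i k
      = \sum_(l < 4) \sum_(k < 4) G l i k * C k j l.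
    rewrite exchange_big /=; apply: eq_bigr => l _.
    by apply: eq_bigr => k _; rewrite mulrC.
  rewrite trace_C2 !sum_CC -gG_W.
  have tE m : \sum_(k < 4) G k m k = t m by apply: eq_bigr => k _; rewrite GC.
  rewrite !tE.
  have -> : \sum_(k < 4) G k j i * w k = \sum_(k < 4) G k i j * w k.
    by apply: eq_bigr => k _; rewrite GC.
  ring.
have split4 (a b : 'I_4 -> R) (c d : 'I_4 -> 'I_4 -> R) :
    \sum_(k < 4) (a k - b k + \sum_(l < 4) (c k l - d k l))
    = \sum_(k < 4) a k - \sum_(k < 4) b k
      + (\sum_(k < 4) \sum_(l < 4) c k l - \sum_(k < 4) \sum_(l < 4) d k l).
  by rewrite -!sumrB -big_split /=; apply: eq_bigr => k _; rewrite sumrB.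
rewrite !split4 q1 q2 /= [X in X - _ + _ = _]sumrB [X in _ - X + _ = _]sumrB.
rewrite d1 d2 [X in _ = _ + (X - _) * _]big_split /=.
have -> : \sum_(k < 4) \sum_(l < 4) G l l k * W k = \sum_(k < 4) t k * W k.
  by apply: eq_bigr => k _; rewrite mulr_suml.
by rewrite -/w2; ring.
Qed.

End ConformalAlgebra.

(** * Levi-Civita connections *)

Section LeviCivita.
Variable R : realType.
Local Notation pt := 'rV[R]_4.
Local Notation symbols := ('I_4 -> 'I_4 -> 'I_4 -> pt -> R).
Implicit Types (U : set pt) (g : pt -> 'M[R]_4) (G : symbols) (p : pt).

(** The symbols [G] define a torsion-free connection on [U] for which [g] is
    parallel. *)
Record levi_civita U g G : Prop := LeviCivita {
  metric_unit : forall p, U p -> g p \in unitmx;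
  metric_sym : forall p i j, U p -> g p i j = g p j i;
  torsion_free : forall p k i j, U p -> G k i j p = G k j i p;
  metric_compat : forall p m i j, U p ->
    is_derive p (coordv R m) (fun q => g q i j)
      (\sum_(l < 4) (g p i l * G l m j p + g p j l * G l m i p));
  symbol_derivable : forall p k i j m, U p -> derivable (G k i j) p (coordv R m) }.

Definition ricci_of_connection G (i j : 'I_4) p : R :=
  \sum_(k < 4)
    (pd k (G k i j) p - pd j (G k i k) p
     + \sum_(l < 4) (G k k l p * G l i j p - G k j l p * G l i k p)).

Lemma pd_eq_on U (f h : pt -> R) (i : 'I_4) p : open U -> U p ->
  (forall q, U q -> f q = h q) -> pd i f p = pd i h p.
Proof.
move=> oU Up fh; apply: near_eq_derive.
by apply: filterS (open_nbhs_nbhs (conj oU Up)) => q /fh.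
Qed.

(** The Koszul formula: solving metric compatibility for the symbols.  It
    makes a guessed table of symbols verifiable without an explicit inverse
    metric. *)
Lemma christoffel_levi_civita U g G p k i j : levi_civita U g G -> U p ->
  christoffel g k i j p = G k i j p.
Proof.
move=> [gu gC GC cpt _] Up; rewrite /christoffel.
have pdE m a b : pd m (fun q => g q a b) p =
    \sum_(l < 4) (g p a l * G l m b p + g p b l * G l m a p).
  by have [] := cpt p m a b Up.
have -> : G k i j p = \sum_(m < 4) (invmx (g p) *m g p) k m * G m i j p.
  rewrite mulVmx ?gu //; under eq_bigr do rewrite mxE.
  rewrite (bigD1 k) //= eqxx mul1r big1 ?addr0 // => m /negPf.
  by rewrite eq_sym => ->; rewrite mul0r.
under [RHS]eq_bigr do rewrite mxE mulr_suml.
rewrite exchange_big /= mulr_sumr; apply: eq_bigr => l _.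
have -> : \sum_(m < 4) invmx (g p) k l * g p l m * G m i j p =
    invmx (g p) k l * \sum_(m < 4) g p l m * G m i j p.
  by rewrite mulr_sumr; apply: eq_bigr => m _; rewrite mulrA.
rewrite mulrCA; congr (_ * _).
rewrite !pdE -big_split -sumrB mulr_sumr /=; apply: eq_bigr => m _.
rewrite (GC p m i l) // (GC p m j l) // (GC p m j i) //.
by field.
Qed.

Lemma ricci_levi_civita U g G p i j : open U -> levi_civita U g G -> U p ->
  ricci g p i j = ricci_of_connection G i j p.
Proof.
move=> oU lc Up; rewrite mxE; apply: eq_bigr => k _.
congr (_ - _ + _).
- by apply: (pd_eq_on _ oU Up) => q; exact: christoffel_levi_civita.
- by apply: (pd_eq_on _ oU Up) => q; exact: christoffel_levi_civita.
by apply: eq_bigr => l _; rewrite !(christoffel_levi_civita _ _ _ lc Up).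
Qed.

(** The coframe diagonalises [h] to diag(1, 1, -1, -1). *)
Lemma signature22_unitmx (h : 'M[R]_4) : signature22 h -> h \in unitmx.
Proof.
move=> [a [b [c [d [Mu ->]]]]].
set M := (X in X \in _) in Mu.
pose D : 'M[R]_4 := diag_mx (\row_(i < 4) [:: 1; 1; -1; -1]`_i).
have -> : symprod a a + symprod b b - symprod c c - symprod d d = M^T *m D *m M.
  apply/matrixP => i j; rewrite /D mul_mx_diag !mxE !big_ord_recl !big_ord0 !mxE /=.
  by field.
rewrite !unitmx_mul unitmx_tr Mu andbT /=.
suff /mulmx1_unit[] : D *m D = 1%:M by [].
apply/matrixP => i j; rewrite /D mul_diag_mx !mxE.
by case: i => -[|[|[|[|//]]]] ?; case: eqP => //= _; rewrite ?mulr1n ?mulr0n ?mulr0; ring.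
Qed.

(** [N] is the gradient of [s]: taking it as a datum, rather than as
    [invmx g] applied to [ds], keeps derivatives of the inverse matrix out of
    the way. *)
Section Rescale.
Variables (U : set pt) (g : pt -> 'M[R]_4) (G : symbols).
Variables (s : pt -> R) (N : 'I_4 -> pt -> R).
Hypothesis oU : open U.
Hypothesis lc : levi_civita U g G.
Hypothesis s_smooth : smooth_on U s.
Hypothesis s_neq0 : forall p, U p -> s p != 0.
Hypothesis N_grad : forall p i, U p ->
  \sum_(k < 4) g p i k * N k p = pd i s p.
Hypothesis N_derivable : forall p k m, U p -> derivable (N k) p (coordv R m).

(* The differential and the gradient of log s. *)
Let w i p := (s p)^-1 * pd i s p.
Let W k p := (s p)^-1 * N k p.

Definition rescaled_symbols : symbols := fun k i j p =>
  G k i j p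
  - ((k == i)%:R * w j p + (k == j)%:R * w i p - g p i j * W k p).

Let s_der p m : U p -> is_derive p (coordv R m) s (pd m s p).
Proof. by move=> Up; apply: derivableP; have [_ d] := s_smooth [::] Up; exact: d. Qed.

Let sV_der p m : U p ->
  is_derive p (coordv R m) (fun q => (s q)^-1) (- (pd m s p * ((s p)^-1 * (s p)^-1))).
Proof.
move=> Up; apply: is_deriveV_dir; first exact: s_neq0.
exact: s_der.
Qed.

Let quot_der (f : pt -> R) p m : U p -> derivable f p (coordv R m) ->
  is_derive p (coordv R m) (fun q => (s q)^-1 * f q)
    ((s p)^-1 * pd m f p - (s p)^-1 * f p * w m p).
Proof.
move=> Up /derivableP fm; apply: is_derive_eq (is_deriveM (sV_der m Up) fm) _.
by rewrite /GRing.scale /= /w /pd /coordv; ring.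
Qed.

Let pds_der p i m : U p -> derivable (pd i s) p (coordv R m).
Proof. by move=> Up; have [_ d] := s_smooth [:: i] Up; exact: d. Qed.

Let dw p m i := (s p)^-1 * pd m (pd i s) p - w i p * w m p.
Let dW p m k := (s p)^-1 * pd m (N k) p - W k p * w m p.

Let w_der p i m : U p -> is_derive p (coordv R m) (w i) (dw p m i).
Proof. by move=> Up; have := quot_der Up (@pds_der p i m Up). Qed.

Let W_der p k m : U p -> is_derive p (coordv R m) (W k) (dW p m k).
Proof. by move=> Up; have := quot_der Up (@N_derivable p k m Up). Qed.

Let gW p i : U p -> \sum_(k < 4) g p i k * W k p = w i p.
Proof.
move=> Up; rewrite /w -N_grad // mulr_sumr.
by apply: eq_bigr => k _; rewrite /W mulrCA.
Qed.

Let dg p m i j := \sum_(l < 4) (g p i l * G l m j p + g p j l * G l m i p).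

Let gW_der p i j m : U p ->
  is_derive p (coordv R m) (fun q => g q i j * W j q)
    (dg p m i j * W j p + g p i j * dW p m j).
Proof.
move=> Up; apply: is_derive_eq.
  apply: is_deriveM; [exact: (metric_compat lc m i j Up)|exact: W_der].
by rewrite /GRing.scale /= /dg; ring.
Qed.

(** Differentiating [gW], an identity between functions on the open set
    [U]. *)
Let dgW p m i : U p ->
  \sum_(k < 4) (dg p m i k * W k p + g p i k * dW p m k) = dw p m i.
Proof.
move=> Up.
have H : is_derive p (coordv R m) (fun q => \sum_(k < 4) g q i k * W k q)
    (\sum_(k < 4) (dg p m i k * W k p + g p i k * dW p m k)).
  rewrite (_ : (fun q => _) = \sum_(k < 4) (fun q => g q i k * W k q)); last first.
    by apply/funext => q; rewrite fct_sumE.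
  by apply: is_derive_sum => k; exact: gW_der.
have [_ <-] := H; have [_ <-] := w_der i m Up.
apply: near_eq_derive; apply: filterS (open_nbhs_nbhs (conj oU Up)) => q Uq.
exact: gW.
Qed.

Let dC p m k i j :=
  (k == i)%:R * dw p m j + (k == j)%:R * dw p m i
  - (dg p m i j * W k p + g p i j * dW p m k).

Let symbols_der p k i j m : U p ->
  is_derive p (coordv R m) (rescaled_symbols k i j)
    (pd m (G k i j) p - dC p m k i j).
Proof.
move=> Up.
have cst_der (c : R) f df : is_derive p (coordv R m) f df ->
    is_derive p (coordv R m) (fun q => c * f q) (c * df).
  by move=> fd; have := @is_deriveZ _ _ _ f c p (coordv R m) df fd.
apply: is_deriveB.
  by apply: derivableP; exact: (symbol_derivable lc).
apply: is_deriveB; first by apply: is_deriveD; apply: cst_der; exact: w_der.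
apply: is_derive_eq.
  apply: is_deriveM; [exact: (metric_compat lc m i j Up)|exact: W_der].
by rewrite /GRing.scale /= /dg; ring.
Qed.

Lemma rescale_levi_civita : levi_civita U (rescale s g) rescaled_symbols.
Proof.
split=> [p Up|p i j Up|p k i j Up|p m i j Up|p k i j m Up].
- rewrite /rescale unitmxZ ?(metric_unit lc) //.
  by rewrite unitfE invr_eq0 expf_neq0 // s_neq0.
- by rewrite !mxE (metric_sym lc).
- rewrite /rescaled_symbols (torsion_free lc k i j Up) (metric_sym lc i j Up).
  by move: (w i p) (w j p) (W k p) (g p j i) (G k j i p) => *; ring.
- under eq_fun do rewrite mxE expr2 invfM -mulrA.
  have H := is_deriveM (sV_der m Up)
              (is_deriveM (sV_der m Up) (metric_compat lc m i j Up)).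
  apply: is_derive_eq H _; rewrite /GRing.scale /=.
  have -> : \sum_(l < 4) (rescale s g p i l * rescaled_symbols l m j p
                       + rescale s g p j l * rescaled_symbols l m i p)
    = (s p)^-1 * (s p)^-1 * (dg p m i j - 2 * (g p i j * w m p)).
    have S a b : U p -> \sum_(l < 4) g p a l *
      ((l == m)%:R * w b p + (l == b)%:R * w m p - g p m b * W l p)
      = g p a m * w b p + g p a b * w m p - g p m b * w a p.
      by move=> Ua; rewrite (@sum_conformal R (g p) (w^~ p) (W^~ p) m b (g p a)) gW.
    transitivity ((s p)^-1 * (s p)^-1 *
      (dg p m i j
       - \sum_(l < 4) g p i l *
           ((l == m)%:R * w j p + (l == j)%:R * w m p - g p m j * W l p)
       - \sum_(l < 4) g p j l *
           ((l == m)%:R * w i p + (l == i)%:R * w m p - g p m i * W l p))).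
      rewrite /dg -!sumrB mulr_sumr; apply: eq_bigr => l _.
      rewrite /rescale /rescaled_symbols !mxE expr2 invfM.
      move: (s p)^-1 (g p i l) (g p j l) (g p m j) (g p m i) => *.
      move: (w i p) (w j p) (w m p) (W l p) (G l m i p) (G l m j p) => *.
      by ring.
    rewrite !S // (metric_sym lc m j) // (metric_sym lc m i) // (metric_sym lc j i) //.
    by move: (dg p m i j) (w i p) (w j p) (w m p) => *; ring.
  by rewrite [X in _ + X * _](_ : _ = (s p)^-1 * g p i j) // /w /dg; ring.
- by have [] := symbols_der k i j m Up.
Qed.

(** The sum of the [pd k (N k) p + \sum_l G l l k p * N k p] is the divergence
    of the gradient, that is the Laplacian of [s]. *)
Lemma ricci_rescale p i j : U p ->
  ricci (rescale s g) p i j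
  = ricci_of_connection G i j p
    + 2 / s p * (pd i (pd j s) p - \sum_(k < 4) G k i j p * pd k s p)
    + (\sum_(k < 4) (pd k (N k) p + \sum_(l < 4) G l l k p * N k p) / s p
       - 3 * (\sum_(k < 4) pd k s p * N k p) / s p ^+ 2) * g p i j.
Proof.
move=> Up; rewrite (ricci_levi_civita _ _ oU rescale_levi_civita Up).
have dE k a b m : pd m (rescaled_symbols k a b) p
    = pd m (G k a b) p - dC p m k a b.
  by have [] := symbols_der k a b m Up.
have -> : ricci_of_connection rescaled_symbols i j p =
  \sum_(k < 4) ((pd k (G k i j) p - dC p k k i j) - (pd j (G k i k) p - dC p j k i k)
    + \sum_(l < 4) (rescaled_symbols k k l p * rescaled_symbols l i j p
                    - rescaled_symbols k j l p * rescaled_symbols l i k p)).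
  by apply: eq_bigr => k _; rewrite !dE.
have dwC a b : dw p a b = dw p b a.
  rewrite /dw (pdC a b oU s_smooth Up).
  by move: (w a p) (w b p) (pd b (pd a s) p) (s p)^-1 => *; ring.
have := @conformal_ricci_algebra R (g p) (fun k a b => G k a b p)
   (fun m k a b => pd m (G k a b) p) (w^~ p) (W^~ p) (dw p) (dW p)
   (fun a b => metric_sym lc a b Up) (fun k a b => torsion_free lc k a b Up)
   dwC (fun a => gW a Up) (fun m a => dgW m a Up) i j.
rewrite /= => E; rewrite {}[LHS]E -/(ricci_of_connection G i j p).
have s0 := s_neq0 Up.
have -> : \sum_(k < 4) G k i j p * w k p =
    (s p)^-1 * \sum_(k < 4) G k i j p * pd k s p.
  by rewrite mulr_sumr; apply: eq_bigr => k _; rewrite /w mulrCA.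
have -> : \sum_(k < 4) w k p * W k p =
    (s p)^-1 * (s p)^-1 * \sum_(k < 4) pd k s p * N k p.
  by rewrite mulr_sumr; apply: eq_bigr => k _; rewrite /w /W; ring.
have -> : \sum_(k < 4) (dW p k k + \sum_(l < 4) G l l k p * W k p) =
    \sum_(k < 4) (pd k (N k) p + \sum_(l < 4) G l l k p * N k p) / s p
    - (s p)^-1 * (s p)^-1 * \sum_(k < 4) pd k s p * N k p.
  rewrite mulr_sumr -sumrB; apply: eq_bigr => k _.
  rewrite -!mulr_suml /dW /W /w; ring.
rewrite /dw /w; move: (pd i (pd j s) p) (pd i s p) (pd j s p) s0 => sij si sj.
move: (s p) (ricci_of_connection G i j p) (g p i j) => S r c S0.
move: (\sum_(k < 4) _) (\sum_(k < 4) _) (\sum_(k < 4) _) => a b d.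
by field.
Qed.

End Rescale.

End LeviCivita.

(** * Formal differentiation *)

(** The four coordinates as constructors, so that tables of tensor components
    can be written by pattern matching and reduce by computation. *)
Inductive axis := Ax | Ay | Au | Av.

Definition index_of (a : axis) : 'I_4 :=
  match a with Ax => ix | Ay => iy | Au => iu | Av => iv end.

Definition axis_of (i : 'I_4) : axis :=
  match nat_of_ord i with 0%N => Ax | 1%N => Ay | 2%N => Au | _ => Av end.

Lemma axis_ofK : cancel axis_of index_of.
Proof. by case=> -[|[|[|[|//]]]] ?; apply: val_inj. Qed.

Lemma index_ofK : cancel index_of axis_of.
Proof. by case. Qed.

Definition axis_eq (a b : axis) : bool :=
  match a, b with
  | Ax, Ax | Ay, Ay | Au, Au | Av, Av => true
  | _, _ => false
  end.

Definition axis_le (a b : axis) : bool :=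
  match a, b with
  | Ax, _ | Ay, Ay | Ay, Au | Ay, Av | Au, Au | Au, Av | Av, Av => true
  | _, _ => false
  end.

Section Terms.
Variable R : realType.
Local Notation pt := 'rV[R]_4.

Lemma sum_axis (F : 'I_4 -> R) :
  \sum_(k < 4) F k = F ix + F iy + F iu + F iv.
Proof.
rewrite !big_ord_recl big_ord0 addr0 !addrA.
by congr (F _ + F _ + F _ + F _); apply: val_inj.
Qed.

(** Expressions in the coordinates and in the partial derivatives of an
    unknown function: [Jet [:: a; b]] is the second derivative along [a] and
    [b], [Jet [::]] the function itself. *)
Inductive term : Type :=
  | Cst of R
  | Var of axis
  | Jet of seq axis
  | Add of term & term
  | Opp of term
  | Mul of term & term
  | Inv of term
  | Exp of term
  | Sin of term
  | Cos of term.

Definition jet (s : pt -> R) (l : seq axis) : pt -> R :=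
  iter_pd (map index_of l) s.

Fixpoint eval (s : pt -> R) (t : term) (p : pt) : R :=
  match t with
  | Cst c => c
  | Var a => p 0 (index_of a)
  | Jet l => jet s l p
  | Add t1 t2 => eval s t1 p + eval s t2 p
  | Opp t1 => - eval s t1 p
  | Mul t1 t2 => eval s t1 p * eval s t2 p
  | Inv t1 => (eval s t1 p)^-1
  | Exp t1 => expR (eval s t1 p)
  | Sin t1 => sin (eval s t1 p)
  | Cos t1 => cos (eval s t1 p)
  end.

(** Keeps the derivatives in a jet in a fixed order, so that equal mixed
    derivatives are syntactically equal terms. *)
Fixpoint insert (a : axis) (l : seq axis) : seq axis :=
  match l with
  | [::] => [:: a]
  | b :: l' => if axis_le a b then a :: b :: l' else b :: insert a l'
  end.

Fixpoint diff (a : axis) (t : term) : term :=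
  match t with
  | Cst c => Cst 0
  | Var b => Cst (if axis_eq a b then 1 else 0)
  | Jet l => Jet (insert a l)
  | Add t1 t2 => Add (diff a t1) (diff a t2)
  | Opp t1 => Opp (diff a t1)
  | Mul t1 t2 => Add (Mul t1 (diff a t2)) (Mul t2 (diff a t1))
  | Inv t1 => Opp (Mul (diff a t1) (Mul (Inv t1) (Inv t1)))
  | Exp t1 => Mul (Exp t1) (diff a t1)
  | Sin t1 => Mul (Cos t1) (diff a t1)
  | Cos t1 => Mul (Opp (Sin t1)) (diff a t1)
  end.

(** Only division can fail: jets are evaluated where the scale is smooth. *)
Fixpoint defined (s : pt -> R) (t : term) (p : pt) : Prop :=
  match t with
  | Cst _ | Var _ | Jet _ => True
  | Add t1 t2 | Mul t1 t2 => defined s t1 p /\ defined s t2 p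
  | Opp t1 | Exp t1 | Sin t1 | Cos t1 => defined s t1 p
  | Inv t1 => eval s t1 p != 0 /\ defined s t1 p
  end.

Lemma defined_diff s a t p : defined s t p -> defined s (diff a t) p.
Proof.
by elim: t => //= [t1 IH1 t2 IH2|t1 IH1 t2 IH2|t1 IH1|t1 IH1|t1 IH1|t1 IH1];
  move=> *; intuition.
Qed.

Lemma smooth_iter_pd (U : set pt) (l : seq 'I_4) (s : pt -> R) :
  smooth_on U s -> smooth_on U (iter_pd l s).
Proof.
move=> ss l'; have -> : iter_pd l' (iter_pd l s) = iter_pd (l' ++ l) s.
  by elim: l' => //= i l' ->.
exact: ss.
Qed.

Section Calculus.
Variables (U : set pt) (s : pt -> R).
Hypothesis oU : open U.
Hypothesis s_smooth : smooth_on U s.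

(** Schwarz's theorem, built into the ordering of jets: no later argument has
    to exchange derivatives of the scale. *)
Lemma jet_insert a l p : U p -> jet s (insert a l) p = pd (index_of a) (jet s l) p.
Proof.
elim: l p => // b l IH p Up /=; case: ifP => // _.
rewrite -[LHS]/(pd (index_of b) (jet s (insert a l)) p).
rewrite (pd_eq_on _ oU Up IH).
by rewrite (pdC _ _ oU (smooth_iter_pd (map index_of l) s_smooth) Up).
Qed.

Lemma coord_der (i j : 'I_4) p :
  is_derive p (coordv R j) (fun q : pt => q 0 i) (j == i)%:R.
Proof.
apply/is_derive_along_line.
rewrite (_ : (fun h : R => _) = (fun h => (j == i)%:R * h + p 0 i)); last first.
  by apply/funext => h; rewrite /coordv !mxE eqxx /= eq_sym mulrC.
have H := is_deriveD (is_deriveZ (j == i)%:R (is_derive_id (0 : R) 1))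
   (is_derive_cst (p 0 i) (0 : R) 1).
by apply: is_derive_eq H _; rewrite /GRing.scale /=; ring.
Qed.

(** Correctness of [diff]; the continuity is what iterated derivatives must
    have for a term to be smooth. *)
Lemma eval_regular t p : U p -> defined s t p ->
  {for p, continuous (eval s t)} /\
  (forall a, is_derive p (coordv R (index_of a)) (eval s t) (eval s (diff a t) p)).
Proof.
move=> Up; elim: t => [c|b|l|t1 IH1 t2 IH2|t1 IH1|t1 IH1 t2 IH2
  |t1 IH1|t1 IH1|t1 IH1|t1 IH1] /=.
- move=> _; split; first exact: cst_continuous.
  by move=> a; exact: is_derive_cst.
- move=> _; split; first exact: coord_continuous.
  move=> a; have := coord_der (index_of b) (index_of a) p.
  by case: a b => -[].
- move=> _; split; first by have [] := s_smooth (map index_of l) Up.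
  move=> a; rewrite jet_insert //; apply: derivableP.
  by have [_ d] := s_smooth (map index_of l) Up; exact: d.
- move=> [/IH1[c1 d1] /IH2[c2 d2]]; split; first exact: continuousD.
  by move=> a; exact: is_deriveD.
- move=> /IH1[c1 d1]; split; first exact: continuousN.
  by move=> a; exact: is_deriveN.
- move=> [/IH1[c1 d1] /IH2[c2 d2]]; split; first exact: continuousM.
  by move=> a; exact: is_deriveM.
- move=> [n0 /IH1[c1 d1]]; split; first exact: continuousV.
  by move=> a; exact: is_deriveV_dir.
- move=> /IH1[c1 d1]; split.
    by apply: continuous_comp => //; exact: continuous_expR.
  by move=> a; apply: (@is_derive_comp_dir _ _ expR).
- move=> /IH1[c1 d1]; split.
    by apply: continuous_comp => //; exact: continuous_sin.
  by move=> a; apply: (@is_derive_comp_dir _ _ sin).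
- move=> /IH1[c1 d1]; split.
    by apply: continuous_comp => //; exact: continuous_cos.
  by move=> a; apply: (@is_derive_comp_dir _ _ cos).
Qed.

Lemma pd_eval a t p : U p -> defined s t p ->
  pd (index_of a) (eval s t) p = eval s (diff a t) p.
Proof. by move=> Up /(eval_regular Up)[_ /(_ a)[]]. Qed.

(** Equations that hold on an open set may be differentiated formally. *)
Lemma diff_eq t1 t2 a p :
  (forall q, U q -> defined s t1 q /\ defined s t2 q) ->
  (forall q, U q -> eval s t1 q = eval s t2 q) -> U p ->
  eval s (diff a t1) p = eval s (diff a t2) p.
Proof.
move=> df E Up; have [d1 d2] := df p Up.
by rewrite -!pd_eval //; exact: pd_eq_on E.
Qed.

End Calculus.

End Terms.

(** * Metrics given by tables *)

Declare Scope term_scope.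
Delimit Scope term_scope with T.
Bind Scope term_scope with term.
Arguments Cst {R} _%_R.
Arguments Var {R} _.
Arguments Jet {R} _.
Notation "a + b" := (Add a b) : term_scope.
Notation "- a" := (Opp a) : term_scope.
Notation "a - b" := (Add a (Opp b)) : term_scope.
Notation "a * b" := (Mul a b) : term_scope.

Section Tables.
Variable R : realType.
Local Notation pt := 'rV[R]_4.

Definition sum4 (F : axis -> term R) : term R := (F Ax + F Ay + F Au + F Av)%T.

Definition ricci_term (G : axis -> axis -> axis -> term R) a b : term R :=
  sum4 (fun k => diff k (G k a b) - diff b (G k a k)
    + sum4 (fun l => G k k l * G l a b - G k b l * G l a k))%T.

Definition hessian_term (G : axis -> axis -> axis -> term R) a b : term R :=
  (diff a (Jet [:: b]) - sum4 (fun k => G k a b * Jet [:: k]))%T.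

Definition divergence_term (G : axis -> axis -> axis -> term R) N : term R :=
  sum4 (fun k => diff k (N k) + sum4 (fun l => G l l k * N k))%T.

(** The finitely many identities to be checked for a concrete metric [g]
    given by the table [gt], with candidate Christoffel symbols [G]. *)
Record table_connection (U : set pt) (s : pt -> R) (g : pt -> 'M[R]_4)
    (gt : axis -> axis -> term R) (G : axis -> axis -> axis -> term R) : Prop :=
  TableConnection {
  table_signature : forall p, U p -> signature22 (g p);
  table_metric : forall p a b, U p ->
    g p (index_of a) (index_of b) = eval s (gt a b) p;
  table_sym : forall a b, gt a b = gt b a;
  table_torsion_free : forall c a b, G c a b = G c b a;
  table_metric_defined : forall p a b, U p -> defined s (gt a b) p;
  table_symbols_defined : forall p c a b, U p -> defined s (G c a b) p;
  table_compat : forall p m a b, U p -> eval s (diff m (gt a b)) p =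
    eval s (sum4 (fun l => gt a l * G l m b + gt b l * G l m a)%T) p }.

Definition table_symbols s (G : axis -> axis -> axis -> term R) k i j : pt -> R :=
  eval s (G (axis_of k) (axis_of i) (axis_of j)).

Section Connection.
Variables (U : set pt) (s : pt -> R) (g : pt -> 'M[R]_4).
Variables (gt : axis -> axis -> term R) (G : axis -> axis -> axis -> term R).
Hypothesis oU : open U.
Hypothesis s_smooth : smooth_on U s.
Hypothesis tc : table_connection U s g gt G.

Lemma table_metricE p i j : U p -> g p i j = eval s (gt (axis_of i) (axis_of j)) p.
Proof.
by move=> Up; rewrite -{1}[i]axis_ofK -{1}[j]axis_ofK (table_metric tc).
Qed.

Lemma pd_table t i p : U p -> defined s t p ->
  pd i (eval s t) p = eval s (diff (axis_of i) t) p.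
Proof. by move=> Up dt; rewrite -[i in LHS]axis_ofK (pd_eval oU s_smooth). Qed.

Lemma table_levi_civita : levi_civita U g (table_symbols s G).
Proof.
split=> [p Up|p i j Up|p k i j Up|p m i j Up|p k i j m Up].
- exact/signature22_unitmx/(table_signature tc).
- by rewrite !table_metricE // (table_sym tc).
- by rewrite /table_symbols (table_torsion_free tc).
- have [_ /(_ (axis_of m)) d] := eval_regular oU s_smooth Up
    (table_metric_defined tc (axis_of i) (axis_of j) Up).
  rewrite axis_ofK in d.
  apply: near_eq_is_derive.
    apply: filterS (open_nbhs_nbhs (conj oU Up)) => q Uq.
    by apply/esym; exact: table_metricE.
  apply: is_derive_eq d _; rewrite (table_compat tc) //.
  under eq_bigr do rewrite !table_metricE // /table_symbols.
  by rewrite sum_axis.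
- have [_ /(_ (axis_of m)) []] := eval_regular oU s_smooth Up
    (table_symbols_defined tc (axis_of k) (axis_of i) (axis_of j) Up).
  by rewrite axis_ofK.
Qed.

Lemma table_ricci_of_connection p a b : U p ->
  ricci_of_connection (table_symbols s G) (index_of a) (index_of b) p
  = eval s (ricci_term G a b) p.
Proof.
move=> Up; have dG := table_symbols_defined tc.
transitivity (\sum_(k < 4) eval s ((fun k => diff k (G k a b) - diff b (G k a k)
    + sum4 (fun l => G k k l * G l a b - G k b l * G l a k))%T (axis_of k)) p).
  apply: eq_bigr => k _; rewrite /table_symbols !index_ofK sum_axis.
  by rewrite !pd_table ?index_ofK //; exact: dG.
by rewrite sum_axis.
Qed.

Lemma table_ricci p a b : U p ->
  ricci g p (index_of a) (index_of b) = eval s (ricci_term G a b) p.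
Proof.
move=> Up; rewrite -table_ricci_of_connection //.
exact: ricci_levi_civita oU table_levi_civita Up.
Qed.

Section Gradient.
Variable N : axis -> term R.
Hypothesis s_neq0 : forall p, U p -> s p != 0.
Hypothesis N_defined : forall p k, U p -> defined s (N k) p.
Hypothesis N_grad : forall p a, U p ->
  eval s (sum4 (fun k => gt a k * N k)%T) p = jet s [:: a] p.

Lemma table_ricci_rescale p a b : U p ->
  ricci (rescale s g) p (index_of a) (index_of b)
  = eval s (ricci_term G a b) p
    + 2 / s p * eval s (hessian_term G a b) p
    + (eval s (divergence_term G N) p / s p
       - 3 * eval s (sum4 (fun k => Jet [:: k] * N k)%T) p / s p ^+ 2)
      * eval s (gt a b) p.
Proof.
move=> Up.
have grad q i : U q ->
    \sum_(k < 4) g q i k * eval s (N (axis_of k)) q = pd i s q.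
  move=> Uq; rewrite sum_axis !table_metricE //.
  by rewrite -[i in RHS]axis_ofK -[RHS]/(jet s [:: axis_of i] q) -N_grad.
have der q k m : U q -> derivable (eval s (N (axis_of k))) q (coordv R m).
  move=> Uq; have [_ /(_ (axis_of m)) []] := eval_regular oU s_smooth Uq
    (N_defined (axis_of k) Uq).
  by rewrite axis_ofK.
rewrite (ricci_rescale oU table_levi_civita s_smooth s_neq0 grad der _ _ Up).
rewrite table_ricci_of_connection // table_metricE // !index_ofK.
congr (_ + _ * _ + (_ - 3 * _ / _) * _).
- rewrite /hessian_term -[RHS]/(jet s (insert a [:: b]) p
      - eval s (sum4 (fun k => G k a b * Jet [:: k])%T) p).
  rewrite (jet_insert oU s_smooth a [:: b] Up); congr (_ - _).
  by rewrite sum_axis /table_symbols !index_ofK.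
- rewrite -mulr_suml; congr (_ / _).
  transitivity (\sum_(k < 4) eval s ((fun k =>
      diff k (N k) + sum4 (fun l => G l l k * N k))%T (axis_of k)) p).
    apply: eq_bigr => k _; rewrite pd_table ?sum_axis //; exact: N_defined.
  by rewrite sum_axis.
- by rewrite sum_axis.
Qed.

End Gradient.
End Connection.

Lemma smooth_cst (U : set pt) (c : R) : smooth_on U (fun=> c).
Proof.
move=> l p _.
have [c' ->] : exists c', iter_pd l (fun=> c) = (fun=> c') :> (pt -> R).
  elim: l => [|i l [c' IH]] /=; first by exists c.
  by exists 0; rewrite IH; apply/funext => q; rewrite /pd derive_cst.
split; first exact: cst_continuous.
by move=> i; exact: derivable_cst.
Qed.

Arguments smooth_cst : clear implicits.

(** [eval] takes a function to interpret jets; for explicit expressions, which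
    contain none, the zero function serves. *)
Lemma smooth_eval (U : set pt) (t : term R) : open U ->
  (forall p, defined (fun=> 0) t p) -> smooth_on U (eval (fun=> 0) t).
Proof.
move=> oU dt l p Up.
(* Terms are closed under derivation. *)
have oT : open [set: pt] by exact: openT.
have [t' [dt' ->]] : exists t', (forall p, defined (fun=> 0) t' p) /\
    iter_pd l (eval (fun=> 0) t) = eval (fun=> 0) t'.
  elim: l => [|i l [t' [dt' IH]]] /=; first by exists t.
  exists (diff (axis_of i) t'); split; first by move=> q; exact: defined_diff.
  rewrite IH; apply/funext => q.
  by rewrite -{1}[i]axis_ofK (pd_eval oT (smooth_cst _ _)).
have [c d] := eval_regular oT (smooth_cst setT 0) (I : setT p) (dt' p).
by split=> // i; have := d (axis_of i); rewrite axis_ofK => -[].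
Qed.

(** The case of a metric that is itself Einstein, with scale 1. *)
Lemma einstein_table_admits (M : local_metric R)
    (gt : axis -> axis -> term R) (G : axis -> axis -> axis -> term R) (lam : R) :
  open (domain M) -> domain M !=set0 ->
  table_connection (domain M) (fun=> 0) (tensor M) gt G ->
  (forall p a b, domain M p ->
     eval (fun=> 0) (ricci_term G a b) p = lam * eval (fun=> 0) (gt a b) p) ->
  admits_einstein_representative M.
Proof.
move=> oD nD tc E; exists (domain M); split=> //.
exists (fun=> 1); split; [exact: smooth_cst|by move=> *; exact: oner_neq0|].
have -> : rescale (fun=> 1) (tensor M) = tensor M.
  by apply/funext => q; rewrite /rescale expr1n invr1 scale1r.
exists lam => p Up; apply/matrixP => i j.
rewrite -[i]axis_ofK -[j]axis_ofK (table_ricci oD (smooth_cst _ _) tc) // E //.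
by rewrite mxE -(table_metric tc).
Qed.

(** The trace-free part of the Einstein equation: [phi] absorbs every multiple
    of the metric. *)
Lemma einstein_hessian (M : local_metric R) (U : set pt) (s : pt -> R)
    (gt : axis -> axis -> term R) (G : axis -> axis -> axis -> term R)
    (N : axis -> term R) :
  open U -> einstein_representative M U s ->
  table_connection U s (tensor M) gt G ->
  (forall p k, U p -> defined s (N k) p) ->
  (forall p a, U p ->
     eval s (sum4 (fun k => gt a k * N k)%T) p = jet s [:: a] p) ->
  exists phi : pt -> R, forall p a b, U p ->
    eval s (hessian_term G a b) p + s p / 2 * eval s (ricci_term G a b) p
    = phi p * eval s (gt a b) p.
Proof.
move=> oU [ss s0 [lam E]] tc dN gN.
exists (fun p => s p / 2 * (lam * (s p) ^- 2
   - (eval s (divergence_term G N) p / s p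
       - 3 * eval s (sum4 (fun k => Jet [:: k] * N k)%T) p / s p ^+ 2))).
move=> p a b Up; have := congr1 (fun m : 'M[R]_4 => m (index_of a) (index_of b)) (E p Up).
rewrite !mxE (table_metric tc) // -[X in X = _](_ : ricci (rescale s (tensor M)) p
  (index_of a) (index_of b) = _); last by rewrite mxE.
rewrite (table_ricci_rescale oU ss tc s0 dN gN) //.
have := s0 p Up.
move: (s p) (eval s (ricci_term G a b) p) (eval s (hessian_term G a b) p)
  (eval s (divergence_term G N) p) (eval s (sum4 _) p) (eval s (gt a b) p).
move=> S r h d n c S0 H.
have -> : h = S / 2 * (2 / S * h) by field.
have -> : 2 / S * h = lam * (S ^- 2 * c) - r - (d / S - 3 * n / S ^+ 2) * c.
  by rewrite -H; ring.
by field.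
Qed.

End Tables.

(** * Tools for the verifications *)

Section Vanishing.
Variables (R : realType) (U : set 'rV[R]_4) (s : 'rV[R]_4 -> R).
Hypothesis oU : open U.
Hypothesis s_smooth : smooth_on U s.

Definition vanishes (t : term R) : Prop := forall p, U p -> eval s t p = 0.

Lemma vanishes_diff a t :
  (forall p, U p -> defined s t p) -> vanishes t -> vanishes (diff a t).
Proof.
move=> dt t0 p Up.
rewrite (@diff_eq _ _ _ oU s_smooth t (Cst 0) a p) //.
by move=> q Uq; split=> //; exact: dt.
Qed.

End Vanishing.

(** [eq0_of_eq] and [eq0_of_eq2] derive [t = 0] from one or two equations by
    exhibiting [t] as their linear combination. *)
Lemma eq0_of_eq (R : realType) (c l1 l2 t : R) : l1 = l2 -> t = c * (l1 - l2) -> t = 0.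
Proof. by move=> -> ->; rewrite subrr mulr0. Qed.

Lemma eq0_of_eq2 (R : realType) (c c' l1 l2 l1' l2' t : R) : l1 = l2 -> l1' = l2' ->
  t = c * (l1 - l2) + c' * (l1' - l2') -> t = 0.
Proof. by move=> -> -> ->; rewrite !subrr !mulr0 addr0. Qed.

Section OpenSets.
Variable R : realType.
Local Notation pt := 'rV[R]_4.

Lemma continuous_eval (t : term R) :
  (forall p, defined (fun=> 0) t p) -> continuous (eval (fun=> 0) t).
Proof.
move=> dt p; have oT : open [set: pt] by exact: openT.
by have [] := eval_regular oT (@smooth_cst R setT 0) (I : setT p) (dt p).
Qed.

Lemma open_eval_neq0 (t : term R) :
  (forall p, defined (fun=> 0) t p) ->
  open [set p | eval (fun=> 0) t p != 0].
Proof.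
move=> dt; apply: (@open_comp _ _ (eval (fun=> 0) t) [set z | z != 0]).
  by move=> p _; exact: continuous_eval.
exact: open_neq.
Qed.

Lemma open_eval_gt0 (t : term R) :
  (forall p, defined (fun=> 0) t p) ->
  open [set p | 0 < eval (fun=> 0) t p].
Proof.
move=> dt; apply: (@open_comp _ _ (eval (fun=> 0) t) [set z | 0 < z]).
  by move=> p _; exact: continuous_eval.
exact: open_gt.
Qed.

End OpenSets.

(* Unfolds formal derivatives and evaluation, leaving a scalar identity in
   coordinates and jets. *)
Ltac eval_terms :=
  cbv [ricci_term hessian_term divergence_term sum4];
  cbv [eval diff insert axis_le axis_eq index_of].

(* Turns a component of the given tensor into a scalar expression. *)
Ltac metric_entry := rewrite /= !(symprodE, mxE) /=.

(* Replaces jets and coordinates at a point by variables: ring and field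
   would otherwise compare them up to unfolding of derivatives. *)
Ltac abstract_point :=
  repeat match goal with
  | |- context [jet ?s ?l ?p] => move: (jet s l p) => ?
  | |- context [fun_of_matrix ?p ?z ?i] => move: (fun_of_matrix p z i) => ?
  end.

(** * The Einstein metrics M9 and M8 *)

Section M9.
Variable R : realType.
Local Notation x := (@Var R Ax).
Local Notation "0" := (@Cst R 0) : term_scope.

Definition M9_metric (a b : axis) : term R :=
  match a, b with
  | Ax, Au | Au, Ax | Ay, Av | Av, Ay => Cst 2^-1
  | Av, Av => x * x
  | _, _ => 0
  end%T.

Definition M9_symbols (c a b : axis) : term R :=
  match c, a, b with
  | Ay, Ax, Av | Ay, Av, Ax => Cst 2 * x
  | Au, Av, Av => Cst (-2) * x
  | _, _, _ => 0
  end%T.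

Lemma M9_connection :
  table_connection setT (fun=> 0) (tensor (M9 R)) M9_metric M9_symbols.
Proof.
split=> [p _|p a b _|a b|c a b|p a b _|p c a b _|p m a b _].
- exact: M9_signature.
- by case: a b => -[]; metric_entry; field.
- by case: a b => -[].
- by case: c a b => -[] [].
- by case: a b => -[].
- by case: c a b => -[] [].
- case: m a b => -[] []; cbv [M9_metric M9_symbols]; eval_terms;
  move: (p 0 ix) => X; by field.
Qed.

(** [x^2 dv^2] contributes through the flat Laplacian of [x^2], a multiple of
    its mixed derivative along [x] and [u], which is zero. *)
Lemma M9_ricci p a b :
  eval (fun=> 0) (ricci_term M9_symbols a b) p = 0.
Proof.
case: a b => -[]; cbv [M9_symbols]; eval_terms; move: (p 0 ix) => X; by ring.
Qed.

Lemma M9_einstein : admits_einstein_representative (M9 R).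
Proof.
apply: (@einstein_table_admits R (M9 R) M9_metric M9_symbols 0).
- exact: openT.
- by exists 0.
- exact: M9_connection.
- by move=> p a b _; rewrite M9_ricci mul0r.
Qed.
End M9.

Section M8_1.
Variable R : realType.
Local Notation x := (@Var R Ax).
Local Notation y := (@Var R Ay).
Local Notation u := (@Var R Au).
Local Notation v := (@Var R Av).
Local Notation "0" := (@Cst R 0) : term_scope.
Local Notation d := (Inv (v + u * x - y)%T).

Definition M8_1_metric (a b : axis) : term R :=
  match a, b with
  | Ax, Au | Au, Ax => - (d * d * (v - y))
  | Ax, Av | Av, Ax => d * d * u
  | Ay, Au | Au, Ay => - (d * d * x)
  | Ay, Av | Av, Ay => - (d * d)
  | _, _ => 0
  end%T.

Definition M8_1_symbols (c a b : axis) : term R :=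
  match c, a, b with
  | Ax, Ax, Ax => Cst (-2) * d * u
  | Ax, Ax, Ay | Ax, Ay, Ax => d
  | Ay, Ax, Ay | Ay, Ay, Ax => - (d * u)
  | Ay, Ay, Ay => Cst 2 * d
  | Au, Au, Au => Cst (-2) * d * x
  | Au, Au, Av | Au, Av, Au => - d
  | Av, Au, Av | Av, Av, Au => - (d * x)
  | Av, Av, Av => Cst (-2) * d
  | _, _, _ => 0
  end%T.

Lemma M8_1_connection :
  table_connection (domain (M8_1 R)) (fun=> 0) (tensor (M8_1 R))
    M8_1_metric M8_1_symbols.
Proof.
split=> [p Dp|p a b /= Dp|a b|c a b|p a b /= Dp|p c a b /= Dp|p m a b /= Dp].
- exact: M8_1_signature.
- move: Dp; case: a b => -[]; metric_entry;
  move: (p 0 ix) (p 0 iy) (p 0 iu) (p 0 iv) => X Y S T Dp; by field.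
- by case: a b => -[].
- by case: c a b => -[] [].
- by case: a b => -[] /=; intuition.
- by case: c a b => -[] [] /=; intuition.
- move: Dp; case: m a b => -[] []; cbv [M8_1_metric M8_1_symbols]; eval_terms;
  move: (p 0 ix) (p 0 iy) (p 0 iu) (p 0 iv) => X Y S T Dp; by field.
Qed.

Lemma M8_1_ricci p a b : domain (M8_1 R) p ->
  eval (fun=> 0) (ricci_term M8_1_symbols a b) p = -3 * eval (fun=> 0) (M8_1_metric a b) p.
Proof.
rewrite /=; case: a b => -[]; cbv [M8_1_symbols M8_1_metric]; eval_terms;
  move: (p 0 ix) (p 0 iy) (p 0 iu) (p 0 iv) => X Y S T Dp; by field.
Qed.

Lemma M8_1_einstein : admits_einstein_representative (M8_1 R).
Proof.
apply: (@einstein_table_admits R (M8_1 R) M8_1_metric M8_1_symbols (-3)).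
- exact: (@open_eval_neq0 R (v + u * x - y)%T).
- by exists (delta_mx 0 iv); rewrite /= !mxE /= subr0 mul0r addr0 oner_neq0.
- exact: M8_1_connection.
- exact: M8_1_ricci.
Qed.

End M8_1.

Section M8_2.
Variable R : realType.
Local Notation x := (@Var R Ax).
Local Notation y := (@Var R Ay).
Local Notation u := (@Var R Au).
Local Notation "0" := (@Cst R 0) : term_scope.
Local Notation d := (Inv (Cst 2 * u + x * x + y * y)%T).

Definition M8_2_metric (a b : axis) : term R :=
  match a, b with
  | Ax, Ax | Ay, Ay => - (Cst 2 * d * d * u)
  | Ax, Au | Au, Ax => d * d * x
  | Ax, Av | Av, Ax => - (d * d * y)
  | Ay, Au | Au, Ay => d * d * y
  | Ay, Av | Av, Ay => d * d * x
  | Au, Au | Av, Av => d * d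
  | _, _ => 0
  end%T.

Definition M8_2_symbols (c a b : axis) : term R :=
  match c, a, b with
  | Ax, Ax, Ax | Ay, Ax, Ay | Ay, Ay, Ax => Cst (-2) * d * x
  | Ax, Ay, Ay => Cst 2 * d * x
  | Ay, Ay, Ay | Ax, Ax, Ay | Ax, Ay, Ax => Cst (-2) * d * y
  | Ay, Ax, Ax => Cst 2 * d * y
  | Ax, Ax, Au | Ax, Au, Ax | Ay, Ay, Au | Ay, Au, Ay
  | Ay, Ax, Av | Ay, Av, Ax => - d
  | Ax, Ay, Av | Ax, Av, Ay => d
  | Au, Ax, Au | Au, Au, Ax | Av, Ax, Av | Av, Av, Ax
  | Av, Ay, Au | Av, Au, Ay => - (d * x)
  | Au, Ay, Av | Au, Av, Ay => d * x
  | Au, Ax, Av | Au, Av, Ax | Au, Ay, Au | Au, Au, Ay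
  | Av, Ay, Av | Av, Av, Ay => - (d * y)
  | Av, Ax, Au | Av, Au, Ax => d * y
  | Au, Au, Au | Av, Au, Av | Av, Av, Au => Cst (-2) * d
  | Au, Av, Av => Cst 2 * d
  | _, _, _ => 0
  end%T.

Lemma M8_2_neq0 p : domain (M8_2 R) p ->
  2 * p 0 iu + p 0 ix * p 0 ix + p 0 iy * p 0 iy != 0.
Proof. by rewrite /= !expr2 => /lt0r_neq0. Qed.

Lemma M8_2_connection :
  table_connection (domain (M8_2 R)) (fun=> 0) (tensor (M8_2 R))
    M8_2_metric M8_2_symbols.
Proof.
split=> [p Dp|p a b /M8_2_neq0|a b|c a b|p a b /M8_2_neq0|p c a b /M8_2_neq0
  |p m a b /M8_2_neq0].
- exact: M8_2_signature.
- case: a b => -[]; metric_entry; move: (p 0 ix) (p 0 iy) (p 0 iu) => X Y S Dp; by field.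
- by case: a b => -[].
- by case: c a b => -[] [].
- by case: a b => -[] /=; intuition.
- by case: c a b => -[] [] /=; intuition.
- case: m a b => -[] []; cbv [M8_2_metric M8_2_symbols]; eval_terms;
  move: (p 0 ix) (p 0 iy) (p 0 iu) => X Y S Dp; by field.
Qed.

Lemma M8_2_ricci p a b : domain (M8_2 R) p ->
  eval (fun=> 0) (ricci_term M8_2_symbols a b) p = -6 * eval (fun=> 0) (M8_2_metric a b) p.
Proof.
move/M8_2_neq0; case: a b => -[]; cbv [M8_2_symbols M8_2_metric]; eval_terms;
  move: (p 0 ix) (p 0 iy) (p 0 iu) => X Y S Dp; by field.
Qed.

Lemma M8_2_einstein : admits_einstein_representative (M8_2 R).
Proof.
apply: (@einstein_table_admits R (M8_2 R) M8_2_metric M8_2_symbols (-6)).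
- rewrite (_ : domain _ = [set p | 0 < eval (fun=> 0) (Cst 2 * u + x * x + y * y)%T p]).
    exact: open_eval_gt0.
  by apply/funext => p /=; rewrite !expr2.
- by exists (delta_mx 0 iu); rewrite /= !mxE /= expr0n !addr0 mulr1 ltr0n.
- exact: M8_2_connection.
- exact: M8_2_ricci.
Qed.

End M8_2.

(** * The Ricci-flat scales of M7 *)

Section M7.
Variables (R : realType) (r eps : R).
Hypothesis epsE : eps = 1 \/ eps = -1.
Local Notation x := (@Var R Ax).
Local Notation y := (@Var R Ay).
Local Notation u := (@Var R Au).
Local Notation v := (@Var R Av).
Local Notation "0" := (@Cst R 0) : term_scope.

Definition M7_metric (a b : axis) : term R :=
  match a, b with
  | Ax, Au | Au, Ax => Cst (-6 * eps)
  | Ay, Av | Av, Ay => Cst 3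
  | Au, Au => Cst (9 * (2 * eps * r ^+ 2 - 1)) + Cst (36 * r) * x + Cst 9 * y * y
  | Au, Av | Av, Au => Cst (6 * eps * r) * y + Cst (12 * eps) * x
  | Av, Av => Cst (12 * r ^+ 2 - 10 * eps) + Cst (-6) * y
  | _, _ => 0
  end%T.

Definition M7_symbols (c a b : axis) : term R :=
  match c, a, b with
  | Ax, Ax, Au | Ax, Au, Ax => Cst (-3 * r * eps)
  | Ax, Ax, Av | Ax, Av, Ax => Cst (-1)
  | Ax, Ay, Au | Ax, Au, Ay => Cst (- 3 / 2 * eps) * y
  | Ax, Ay, Av | Ax, Av, Ay => Cst (- r / 2)
  | Ax, Au, Au => Cst (9 * r ^+ 3 * eps - 9 / 2 * r) + Cst (3 / 2 * r) * y * y
      + Cst (18 * r ^+ 2) * x - Cst 6 * x * y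
  | Ax, Au, Av | Ax, Av, Au => Cst (3 * r ^+ 2 - 3 / 2 * eps)
      - Cst (r ^+ 2 * eps) * y + Cst (3 / 2 * eps) * y * y
      + Cst (4 * r * eps) * x
  | Ax, Av, Av => Cst r * y + Cst 2 * x
  | Ay, Ax, Au | Ay, Au, Ax => Cst (2 * eps)
  | Ay, Ay, Au | Ay, Au, Ay => Cst (r * eps)
  | Ay, Ay, Av | Ay, Av, Ay => Cst (-1)
  | Ay, Au, Au => Cst (6 * r ^+ 2 - 10 * eps) * y - Cst 6 * y * y
      - Cst (12 * r) * x
  | Ay, Au, Av | Ay, Av, Au => Cst (4 * r ^+ 3 * eps - 10 / 3 * r)
      - Cst (4 * r * eps) * y - Cst (4 * eps) * x
  | Ay, Av, Av => Cst (10 / 3 * eps - 4 * r ^+ 2) + Cst 2 * y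
  | Au, Au, Au => Cst (3 * r * eps)
  | Au, Au, Av | Au, Av, Au => Cst 1
  | Av, Au, Au => Cst (-3) * y
  | Av, Au, Av | Av, Av, Au => Cst (- r * eps)
  | Av, Av, Av => Cst 1
  | _, _, _ => 0
  end%T.

Lemma M7_connection U s :
  table_connection U s (tensor (M7 r eps)) M7_metric M7_symbols.
Proof.
split=> [p _|p a b _|a b|c a b|p a b _|p c a b _|p m a b _].
- exact: M7_signature.
- case: a b => -[]; metric_entry; move: (p 0 ix) (p 0 iy) => X Y;
  by field.
- by case: a b => -[].
- by case: c a b => -[] [].
- by case: a b => -[].
- by case: c a b => -[] [].
- case: m a b => -[] []; cbv [M7_metric M7_symbols]; eval_terms;
  move: (p 0 ix) (p 0 iy) => X Y; case: epsE => epsV; rewrite ?epsV; by field.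
Qed.

(** The gradient of a scale that depends on [u] and [v] only. *)
Definition M7_gradient (k : axis) : term R :=
  match k with
  | Ax => Cst (- eps / 6) * Jet [:: Au]
  | Ay => Cst 3^-1 * Jet [:: Av]
  | _ => 0
  end%T.

(** The gradient lies in the span of the x and y directions, on which both
    the metric and [ds] vanish, so it is null; its divergence vanishes too, and
    what is left of the conformal change is [Ric + (2/s) Hess(s)]. *)
Lemma M7_scale U s : open U -> smooth_on U s -> (forall p, U p -> s p != 0) ->
  (forall p, U p -> jet s [:: Ax] p = 0) ->
  (forall p, U p -> jet s [:: Ay] p = 0) ->
  (forall p, U p -> jet s [:: Av] p = s p) ->
  (forall p, U p -> jet s [:: Au; Au] p =
     3 * r * eps * jet s [:: Au] p + (5 * eps - 2 * r ^+ 2) * s p) ->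
  einstein_representative (M7 r eps) U s.
Proof.
move=> oU ss s0 sx sy sv suu; split=> //; exists 0 => p Up.
have dx1 a : jet s (insert a [:: Ax]) p = 0.
  by have /= := vanishes_diff oU ss (t := Jet [:: Ax]) a (fun _ _ => I) sx; apply.
have dy1 a : jet s (insert a [:: Ay]) p = 0.
  by have /= := vanishes_diff oU ss (t := Jet [:: Ay]) a (fun _ _ => I) sy; apply.
have dv1 a : jet s (insert a [:: Av]) p = jet s [:: a] p.
  exact: (@diff_eq _ _ _ oU ss (Jet [:: Av]) (Jet [::]) a p).
have := sx p Up; have := sy p Up; have := sv p Up; have := suu p Up.
have := dx1 Ax; have := dx1 Ay; have := dx1 Au; have := dx1 Av.
have := dy1 Ay; have := dy1 Au; have := dy1 Av; have := dv1 Au; have := dv1 Av.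
rewrite /= => jvv juv jyv jyu jyy jxv jxu jxy jxx juu jv jy jx.
apply/matrixP => i j; rewrite -[i]axis_ofK -[j]axis_ofK.
rewrite (@table_ricci_rescale _ _ _ _ _ _ oU ss (M7_connection U s) M7_gradient) //.
- rewrite !mxE mul0r; have := s0 p Up.
  case: (axis_of i) (axis_of j) => -[];
  cbv [M7_metric M7_symbols M7_gradient]; eval_terms;
  rewrite !(jvv, juv, jyv, jyu, jyy, jxv, jxu, jxy, jxx, juu, jv, jy, jx);
  move: (s p) (jet s [:: Au] p) (p 0 ix) (p 0 iy) => S Su X Y S0;
  case: epsE => epsV; rewrite ?epsV; by field.
- by move=> q; case.
- move=> q a Uq; case: a; cbv [M7_metric M7_gradient]; eval_terms;
  rewrite ?sx ?sy //; move: (jet s [:: Au] q) (jet s [:: Av] q) (p 0 ix) (p 0 iy) => Su Sv X Y;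
  case: epsE => epsV; rewrite ?epsV; by field.
Qed.

(** The number [a + i b] is a root of
    [X^2 - 3 r eps X + 2 r^2 - 5 eps], of discriminant [r^2 + 20 eps]; the two
    equations are the real part and the imaginary part. *)
Lemma M7_exponents : exists a b : R,
  a ^+ 2 - b ^+ 2 = 3 * r * eps * a + (5 * eps - 2 * r ^+ 2) /\
  b * (2 * a - 3 * r * eps) = 0.
Proof.
have e2 : eps ^+ 2 = 1 by case: epsE => ->; ring.
have [d0|d0] := leP 0 (r ^+ 2 + 20 * eps).
  exists ((3 * r * eps + Num.sqrt (r ^+ 2 + 20 * eps)) / 2), 0; split; last by ring.
  have := sqr_sqrtr d0; move: (Num.sqrt _) => q qE.
  transitivity ((9 * r ^+ 2 * eps ^+ 2 + 6 * r * eps * q + q ^+ 2) / 4); first by field.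
  rewrite qE e2.
  transitivity (9 * r ^+ 2 * eps ^+ 2 / 2 + 3 / 2 * r * eps * q + (5 * eps - 2 * r ^+ 2)).
    by rewrite e2; field.
  by field.
exists (3 * r * eps / 2), (Num.sqrt (- (r ^+ 2 + 20 * eps)) / 2); split; last by field.
have d1 : 0 <= - (r ^+ 2 + 20 * eps) by rewrite oppr_ge0 ltW.
have := sqr_sqrtr d1; move: (Num.sqrt _) => q qE.
transitivity (9 * r ^+ 2 * eps ^+ 2 / 4 - q ^+ 2 / 4); first by field.
rewrite qE e2.
transitivity (9 * r ^+ 2 * eps ^+ 2 / 2 + (5 * eps - 2 * r ^+ 2)).
  by rewrite e2; field.
by field.
Qed.

(** The scale is [exp(v + a u) cos(b u)], nonzero near the origin. *)
Lemma M7_einstein : admits_einstein_representative (M7 r eps).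
Proof.
have [a [b [Eab Eb]]] := M7_exponents.
pose c := Cos (Cst b * u)%T.
pose t := (Exp (v + Cst a * u) * c)%T.
pose U := [set p | eval (fun=> 0) c p != 0].
have oU : open U by exact: open_eval_neq0.
exists U; split=> //.
  by exists 0; rewrite /U /= mxE mulr0 cos0 oner_neq0.
have dt p : defined (fun=> 0) t p by [].
exists (eval (fun=> 0) t).
have st W : open W -> smooth_on W (eval (fun=> 0) t) by move=> oW; exact: smooth_eval.
have jE k p : jet (eval (fun=> 0) t) [:: k] p = eval (fun=> 0) (diff k t) p.
  exact: (pd_eval openT (@smooth_cst R setT 0) k (I : setT p) (dt p)).
have juE p : jet (eval (fun=> 0) t) [:: Au; Au] p =
    eval (fun=> 0) (diff Au (diff Au t)) p.
  rewrite -(pd_eval openT (@smooth_cst R setT 0) Au (I : setT p)) //.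
  rewrite -[LHS]/(pd iu (jet (eval (fun=> 0) t) [:: Au]) p).
  by congr (pd _ _ p); apply/funext => q; exact: jE.
apply: M7_scale => //.
- exact: st.
- by move=> p Up; rewrite /= mulf_neq0 // gt_eqF // expR_gt0.
- by move=> p _; rewrite jE; cbv [t c]; eval_terms; ring.
- by move=> p _; rewrite jE; cbv [t c]; eval_terms; ring.
- by move=> p _; rewrite jE; cbv [t c]; eval_terms; ring.
- move=> p _; rewrite juE jE; cbv [t c]; eval_terms.
  move: (p 0 iu) (p 0 iv) => S T.
  move: (expR _) (sin _) (cos _) => e si co.
  transitivity (e * ((a ^+ 2 - b ^+ 2) * co - 2 * a * b * si)); first by ring.
  rewrite Eab.
  have -> : 2 * a * b = 3 * r * eps * b by rewrite -[RHS]addr0 -Eb; ring.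
  by ring.
Qed.

End M7.

(** * Absence of Einstein scales for M6S *)

Section M6S.
Variables (R : realType) (kappa eps : R).
Hypothesis epsE : eps = 1 \/ eps = -1.
Hypothesis kappa_neq0 : kappa != 0.
Local Notation x := (@Var R Ax).
Local Notation y := (@Var R Ay).
Local Notation u := (@Var R Au).
Local Notation v := (@Var R Av).
Local Notation "0" := (@Cst R 0) : term_scope.

(** Dividing [da^2 + eps db^2] by the square of this factor gives constant
    curvature [4 k]. *)
Definition disc_factor k a b : term R :=
  (Cst 1 + Cst k * (Var a * Var a + Cst eps * (Var b * Var b)))%T.
Local Notation D := (disc_factor kappa Ax Ay).
Local Notation E := (disc_factor (9 * kappa) Au Av).

Definition M6S_metric (a b : axis) : term R :=
  match a, b with
  | Ax, Ax => Inv D * Inv D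
  | Ay, Ay => Cst eps * Inv D * Inv D
  | Au, Au => - (Inv E * Inv E)
  | Av, Av => - (Cst eps * Inv E * Inv E)
  | _, _ => 0
  end%T.

Definition M6S_symbols (c a b : axis) : term R :=
  match c, a, b with
  | Ax, Ax, Ax | Ay, Ax, Ay | Ay, Ay, Ax => Cst (-2 * kappa) * x * Inv D
  | Ax, Ay, Ay => Cst (2 * kappa * eps) * x * Inv D
  | Ay, Ay, Ay | Ax, Ax, Ay | Ax, Ay, Ax => Cst (-2 * kappa * eps) * y * Inv D
  | Ay, Ax, Ax => Cst (2 * kappa) * y * Inv D
  | Au, Au, Au | Av, Au, Av | Av, Av, Au => Cst (-18 * kappa) * u * Inv E
  | Au, Av, Av => Cst (18 * kappa * eps) * u * Inv E
  | Av, Av, Av | Au, Au, Av | Au, Av, Au => Cst (-18 * kappa * eps) * v * Inv E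
  | Av, Au, Au => Cst (18 * kappa) * v * Inv E
  | _, _, _ => 0
  end%T.

Lemma M6S_neq0 p : domain (M6S kappa eps) p ->
  1 + kappa * (p 0 ix * p 0 ix + eps * (p 0 iy * p 0 iy)) != 0 /\
  1 + 9 * kappa * (p 0 iu * p 0 iu + eps * (p 0 iv * p 0 iv)) != 0.
Proof. by rewrite /= !expr2. Qed.

Lemma M6S_connection U s : U `<=` domain (M6S kappa eps) ->
  table_connection U s (tensor (M6S kappa eps)) M6S_metric M6S_symbols.
Proof.
move=> UD; have df p : U p -> _ := fun Up => M6S_neq0 (UD p Up).
split=> [p /UD|p a b /df[]|a b|c a b|p a b /df[]|p c a b /df[]|p m a b /df[]].
- exact: M6S_signature.
- case: a b => -[]; metric_entry; rewrite !expr2;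
  move: (p 0 ix) (p 0 iy) (p 0 iu) (p 0 iv) => X Y S T D0 E0; field; by rewrite ?D0 ?E0.
- by case: a b => -[].
- by case: c a b => -[] [].
- by case: a b => -[] /=; intuition.
- by case: c a b => -[] [] /=; intuition.
- case: m a b => -[] []; cbv [M6S_metric M6S_symbols disc_factor]; eval_terms;
  move: (p 0 ix) (p 0 iy) (p 0 iu) (p 0 iv) => X Y S T D0 E0; field; by rewrite ?D0 ?E0.
Qed.

Definition M6S_gradient (k : axis) : term R :=
  match k with
  | Ax => D * D * Jet [:: Ax]
  | Ay => Cst eps * D * D * Jet [:: Ay]
  | Au => - (E * E * Jet [:: Au])
  | Av => - (Cst eps * E * E * Jet [:: Av])
  end%T.

(** The surface with coordinates [X, Y], metric [D^-2 (dX^2 + eps dY^2)] and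
    curvature [4 k].  The first two equations are the trace-free part of the
    Hessian, the third is the Y-derivative of the first, and the last is the
    X-derivative of [D^2 Hess_XX + rest = 0] where [d rest = c ds], with
    [Hess_XX] written as [eps Hess_YY] to avoid [s111].  The commutation of
    third derivatives gives [d (D^2 Hess_XX) = -4 k ds], whence the
    conclusion. *)
Lemma block_gradient_fst (k c X Y s1 s2 s11 s12 s22 s122 : R) :
  let D := 1 + k * (X * X + eps * (Y * Y)) in
  D * s12 + 2 * k * eps * Y * s1 + 2 * k * X * s2 = 0 ->
  D * (s11 - eps * s22) + 4 * k * X * s1 - 4 * k * Y * s2 = 0 ->
  D * s122 + 4 * k * eps * Y * s12 + 2 * k * eps * s1 + 2 * k * X * s22 = 0 ->
  eps * D * D * s122 + 4 * k * eps * X * D * s22 + 4 * k * k * X * Y * s2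
    + 2 * k * Y * D * s12 - 4 * k * k * X * X * s1 - 2 * k * D * s1
    - 2 * k * X * D * s11 + c * s1 = 0 ->
  (c - 4 * k) * s1 = 0.
Proof.
move=> D o d o2 q.
transitivity
  ((eps * D * D * s122 + 4 * k * eps * X * D * s22 + 4 * k * k * X * Y * s2
    + 2 * k * Y * D * s12 - 4 * k * k * X * X * s1 - 2 * k * D * s1
    - 2 * k * X * D * s11 + c * s1)
   - eps * D * (D * s122 + 4 * k * eps * Y * s12 + 2 * k * eps * s1 + 2 * k * X * s22)
   + 2 * k * Y * (D * s12 + 2 * k * eps * Y * s1 + 2 * k * X * s2)
   + 2 * k * X * (D * (s11 - eps * s22) + 4 * k * X * s1 - 4 * k * Y * s2)).
  by rewrite /D; case: epsE => ->; ring.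
by rewrite o d o2 q; ring.
Qed.

(** The same along [Y]; here the [Hess_XX] form is the one that avoids
    [s222]. *)
Lemma block_gradient_snd (k c X Y s1 s2 s11 s12 s22 s112 : R) :
  let D := 1 + k * (X * X + eps * (Y * Y)) in
  D * s12 + 2 * k * eps * Y * s1 + 2 * k * X * s2 = 0 ->
  D * (s11 - eps * s22) + 4 * k * X * s1 - 4 * k * Y * s2 = 0 ->
  D * s112 + 4 * k * X * s12 + 2 * k * s2 + 2 * k * eps * Y * s11 = 0 ->
  D * D * s112 + 4 * k * eps * Y * D * s11 + 4 * k * k * eps * X * Y * s1
    + 2 * k * X * D * s12 - 4 * k * k * eps * Y * Y * s2 - 2 * k * D * s2
    - 2 * k * Y * D * s22 + c * s2 = 0 ->
  (c - 4 * k) * s2 = 0.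
Proof.
move=> D o d o2 q.
transitivity
  ((D * D * s112 + 4 * k * eps * Y * D * s11 + 4 * k * k * eps * X * Y * s1
    + 2 * k * X * D * s12 - 4 * k * k * eps * Y * Y * s2 - 2 * k * D * s2
    - 2 * k * Y * D * s22 + c * s2)
   - D * (D * s112 + 4 * k * X * s12 + 2 * k * s2 + 2 * k * eps * Y * s11)
   + 2 * k * X * (D * s12 + 2 * k * eps * Y * s1 + 2 * k * X * s2)
   - 2 * k * eps * Y * (D * (s11 - eps * s22) + 4 * k * X * s1 - 4 * k * Y * s2)).
  by rewrite /D; case: epsE => ->; ring.
by rewrite o d o2 q; ring.
Qed.

(** [D Hess_ab], and [D^2 Hess_aa], [eps D^2 Hess_bb] for the surface metric
    [D^-2 (da^2 + eps db^2)]. *)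
Definition off_diagonal k a b : term R :=
  (disc_factor k a b * Jet [:: a; b] + Cst (2 * k * eps) * Var b * Jet [:: a]
   + Cst (2 * k) * Var a * Jet [:: b])%T.
Definition diagonal1 k a b : term R :=
  (disc_factor k a b * disc_factor k a b * Jet [:: a; a]
   + Cst (2 * k) * Var a * disc_factor k a b * Jet [:: a]
   - Cst (2 * k) * Var b * disc_factor k a b * Jet [:: b])%T.
Definition diagonal2 k a b : term R :=
  (Cst eps * (disc_factor k a b * disc_factor k a b) * Jet [:: b; b]
   + Cst (2 * k) * Var b * disc_factor k a b * Jet [:: b]
   - Cst (2 * k) * Var a * disc_factor k a b * Jet [:: a])%T.

Local Ltac block_ring ab :=
  case: ab => -[-> ->];
  cbv [diagonal1 diagonal2 off_diagonal disc_factor]; eval_terms;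
  abstract_point;
  case: epsE => ->; ring.

(** One factor of the product.  In the application [rest] collects the
    contribution of the other factor and the zeroth-order term, so that its
    differential along this factor is [c ds]. *)
Lemma block_gradient U s k c a b rest :
  open U -> smooth_on U s -> (a, b) = (Ax, Ay) \/ (a, b) = (Au, Av) ->
  (forall p, U p -> eval s (disc_factor k a b) p != 0) ->
  (forall p, U p -> defined s rest p) ->
  (forall p, U p -> eval s (diff a rest) p = c * jet s [:: a] p) ->
  (forall p, U p -> eval s (diff b rest) p = c * jet s [:: b] p) ->
  vanishes U s (off_diagonal k a b) ->
  vanishes U s (diagonal1 k a b + rest)%T -> vanishes U s (diagonal2 k a b + rest)%T ->
  c - 4 * k != 0 ->
  forall p, U p -> jet s [:: a] p = 0 /\ jet s [:: b] p = 0.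
Proof.
move=> oU ss ab D0 dr ra rb o t1 t2 ck p Up.
have o_b := vanishes_diff oU ss (t := off_diagonal k a b) b (ltac:(by [])) o Up.
have o_a := vanishes_diff oU ss (t := off_diagonal k a b) a (ltac:(by [])) o Up.
have t1_b := vanishes_diff oU ss (t := (diagonal1 k a b + rest)%T) b
  (ltac:(by move=> q Uq; split; [|exact: dr])) t1 Up.
have t2_a := vanishes_diff oU ss (t := (diagonal2 k a b + rest)%T) a
  (ltac:(by move=> q Uq; split; [|exact: dr])) t2 Up.
have d : eval s (diagonal1 k a b) p - eval s (diagonal2 k a b) p = 0.
  have e1 : eval s (diagonal1 k a b) p + eval s rest p = 0 := t1 p Up.
  have e2 : eval s (diagonal2 k a b) p + eval s rest p = 0 := t2 p Up.
  move: (eval s (diagonal1 k a b) p) (eval s (diagonal2 k a b) p)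
    (eval s rest p) e1 e2 => A B C e1 e2.
  by rewrite -[RHS](subrr 0) -{1}e1 -e2; ring.
have {}o := o p Up.
have {}t1_b : eval s (diff b (diagonal1 k a b)) p + eval s (diff b rest) p = 0 := t1_b.
rewrite rb // in t1_b.
have {}t2_a : eval s (diff a (diagonal2 k a b)) p + eval s (diff a rest) p = 0 := t2_a.
rewrite ra // in t2_a.
have {}D0 := D0 p Up.
split; apply: (mulfI ck); rewrite mulr0.
  apply: (@block_gradient_fst k c (p 0 (index_of a)) (p 0 (index_of b))
    (jet s [:: a] p) (jet s [:: b] p) (jet s [:: a; a] p) (jet s [:: a; b] p)
    (jet s [:: b; b] p) (jet s [:: a; b; b] p)).
  - by rewrite -[RHS]o; block_ring ab.
  - by apply: (mulfI D0); rewrite mulr0 -[RHS]d; block_ring ab.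
  - by rewrite -[RHS]o_b; block_ring ab.
  - by rewrite -[RHS]t2_a; block_ring ab.
apply: (@block_gradient_snd k c (p 0 (index_of a)) (p 0 (index_of b))
    (jet s [:: a] p) (jet s [:: b] p) (jet s [:: a; a] p) (jet s [:: a; b] p)
    (jet s [:: b; b] p) (jet s [:: a; a; b] p)).
- by rewrite -[RHS]o; block_ring ab.
- by apply: (mulfI D0); rewrite mulr0 -[RHS]d; block_ring ab.
- by rewrite -[RHS]o_a; block_ring ab.
- by rewrite -[RHS]t1_b; block_ring ab.
Qed.

Lemma M6S_nowhere : nowhere_einstein_representative (M6S kappa eps).
Proof.
move=> U oU [p0 Up0] UD [s es]; have [ss s0 _] := es.
have [||phi H] := @einstein_hessian R (M6S kappa eps) U s M6S_metric M6S_symbols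
  M6S_gradient oU es (M6S_connection s UD).
- by move=> p [].
- move=> p a Up; have := M6S_neq0 (UD p Up); case: a => -[D0 E0];
    cbv [M6S_metric M6S_gradient disc_factor]; eval_terms; move: D0 E0; abstract_point;
    case: epsE => ->; rewrite ?mul1r ?mulN1r => D0 E0; field; by rewrite ?D0 ?E0.
have mixed a b : a = Ax \/ a = Ay -> b = Au \/ b = Av -> vanishes U s (Jet [:: a; b]).
  move=> ha hb p Up; apply: (@eq0_of_eq R 1 _ _ _ (H p a b Up)).
  by case: ha hb => -> [] ->; cbv [M6S_metric M6S_symbols disc_factor];
    eval_terms; abstract_point; ring.
(* In s/2 Ric the factors contribute 2 kappa s and 18 kappa s, and the two add
   up because g2 enters the metric with a minus sign. *)
pose cs : term R := (Cst (20 * kappa) * Jet [::])%T.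
have offxy : vanishes U s (off_diagonal kappa Ax Ay).
  move=> p Up; have [D0 E0] := M6S_neq0 (UD p Up).
  apply: (@eq0_of_eq R (eval s (disc_factor kappa Ax Ay) p) _ _ _ (H p Ax Ay Up)).
  move: D0 E0; cbv [M6S_metric M6S_symbols off_diagonal disc_factor];
  eval_terms; abstract_point => D0 E0.
  by field; rewrite ?D0 ?E0.
have offuv : vanishes U s (off_diagonal (9 * kappa) Au Av).
  move=> p Up; have [D0 E0] := M6S_neq0 (UD p Up).
  apply: (@eq0_of_eq R (eval s (disc_factor (9 * kappa) Au Av) p) _ _ _ (H p Au Av Up)).
  move: D0 E0; cbv [M6S_metric M6S_symbols off_diagonal disc_factor];
  eval_terms; abstract_point => D0 E0.
  by field; rewrite ?D0 ?E0.
(* D^2 times the aa-component plus E^2 times the bb-component, which cancels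
   phi; either diagonal component may be used on either factor. *)
have trace t1 t2 a b c d :
    [/\ a = Ax, c = 1 & t1 = diagonal1 kappa Ax Ay] \/
      [/\ a = Ay, c = eps & t1 = diagonal2 kappa Ax Ay] ->
    [/\ b = Au, d = 1 & t2 = diagonal1 (9 * kappa) Au Av] \/
      [/\ b = Av, d = eps & t2 = diagonal2 (9 * kappa) Au Av] ->
    vanishes U s (t1 + (t2 + cs))%T.
  move=> h1 h2 p Up; have [D0 E0] := M6S_neq0 (UD p Up).
  apply: (@eq0_of_eq2 R (c * eval s (disc_factor kappa Ax Ay) p ^+ 2)
    (d * eval s (disc_factor (9 * kappa) Au Av) p ^+ 2) _ _ _ _ _ (H p a a Up) (H p b b Up)).
  move: D0 E0; rewrite -[s p]/(jet s [::] p).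
  case: h1 h2 => -[-> -> ->] [] [-> -> ->];
    cbv [M6S_metric M6S_symbols diagonal1 diagonal2 disc_factor cs]; eval_terms;
    abstract_point; move: (phi p) => Phi; case: epsE => ->; rewrite ?mul1r ?mulN1r => D0 E0;
    field; by rewrite ?D0 ?E0.
have rest_uv a : a = Ax \/ a = Ay -> forall p, U p ->
    eval s (diff a (diagonal1 (9 * kappa) Au Av + cs)%T) p = 20 * kappa * jet s [:: a] p.
  move=> ha p Up.
  have mu := mixed a Au ha (or_introl erefl); have mv := mixed a Av ha (or_intror erefl).
  have muu := vanishes_diff oU ss (t := Jet [:: a; Au]) Au (fun _ _ => I) mu.
  move: (mu p Up) (mv p Up) (muu p Up); case: ha => ->;
    cbv [diagonal1 disc_factor cs]; eval_terms => -> -> ->; abstract_point; ring.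
have rest_xy a : a = Au \/ a = Av -> forall p, U p ->
    eval s (diff a (diagonal1 kappa Ax Ay + cs)%T) p = 20 * kappa * jet s [:: a] p.
  move=> ha p Up.
  have mx := mixed Ax a (or_introl erefl) ha; have my := mixed Ay a (or_intror erefl) ha.
  have mxx := vanishes_diff oU ss (t := Jet [:: Ax; a]) Ax (fun _ _ => I) mx.
  move: (mx p Up) (my p Up) (mxx p Up); case: ha => ->;
    cbv [diagonal1 disc_factor cs]; eval_terms => -> -> ->; abstract_point; ring.
(* On the first factor c - 4 k is 20 kappa - 4 kappa. *)
have gxy p : U p -> jet s [:: Ax] p = 0 /\ jet s [:: Ay] p = 0.
  apply: (@block_gradient U s kappa (20 * kappa) Ax Ay (diagonal1 (9 * kappa) Au Av + cs)%T) => //.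
  - by left.
  - by move=> q Uq; have [] := M6S_neq0 (UD q Uq).
  - by apply: rest_uv; left.
  - by apply: rest_uv; right.
  - by apply: (trace _ _ Ax Au 1 1); left.
  - by apply: (trace _ _ Ay Au eps 1); [right|left].
  - rewrite (_ : _ - _ = 16 * kappa); last by ring.
    by rewrite mulf_neq0 // pnatr_eq0.
have swap t1 t2 t3 : vanishes U s (t1 + (t2 + t3))%T -> vanishes U s (t2 + (t1 + t3))%T.
  by move=> h p Up; rewrite -[RHS](h p Up) /= addrCA.
(* On the second factor c - 4 k is 20 kappa - 36 kappa. *)
have guv p : U p -> jet s [:: Au] p = 0 /\ jet s [:: Av] p = 0.
  apply: (@block_gradient U s (9 * kappa) (20 * kappa) Au Av (diagonal1 kappa Ax Ay + cs)%T) => //.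
  - by right.
  - by move=> q Uq; have [] := M6S_neq0 (UD q Uq).
  - by apply: rest_xy; left.
  - by apply: rest_xy; right.
  - by apply/swap/(trace _ _ Ax Au 1 1); left.
  - by apply/swap/(trace _ _ Ax Av 1 eps); [left|right].
  - rewrite (_ : _ - _ = - 16 * kappa); last by ring.
    by rewrite mulf_neq0 // oppr_eq0 pnatr_eq0.
(* Now s is locally constant, and the trace equation reads 20 kappa s = 0. *)
have sx : vanishes U s (Jet [:: Ax]) by move=> p /gxy[].
have su : vanishes U s (Jet [:: Au]) by move=> p /guv[].
have sxx := vanishes_diff oU ss (t := Jet [:: Ax]) Ax (fun _ _ => I) sx.
have suu := vanishes_diff oU ss (t := Jet [:: Au]) Au (fun _ _ => I) su.
have tr := trace _ _ Ax Au 1 1 (or_introl (And3 erefl erefl erefl))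
  (or_introl (And3 erefl erefl erefl)).
have /eqP := s0 p0 Up0; apply.
have k0 : 20 * kappa != 0 by rewrite mulf_neq0 // pnatr_eq0.
apply: (mulfI k0); rewrite mulr0 -[RHS](tr p0 Up0) -[s p0]/(jet s [::] p0).
move: (sxx p0 Up0) (suu p0 Up0) (gxy p0 Up0) (guv p0 Up0).
cbv [diagonal1 disc_factor cs]; eval_terms => -> -> [-> ->] [-> ->]; abstract_point; ring.
Qed.

End M6S.

(** * Absence of Einstein scales for M6N *)

Section M6N.
Variable R : realType.
Local Notation u := (@Var R Au).
Local Notation "0" := (@Cst R 0) : term_scope.
Local Notation e := (Exp (Cst 2 * @Var R Av)%T).

Definition M6N_metric (a b : axis) : term R :=
  match a, b with
  | Ay, Au | Au, Ay | Ax, Av | Av, Ax => Cst 2^-1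
  | Ax, Ay | Ay, Ax => e
  | Ay, Ay => Cst (-2) * e * u
  | Ay, Av | Av, Ay => Cst (- 2^-1) * u
  | _, _ => 0
  end%T.

Definition M6N_symbols (c a b : axis) : term R :=
  match c, a, b with
  | Ax, Ax, Ay | Ax, Ay, Ax => Cst (-2) * e
  | Ax, Ay, Ay => Cst 6 * u * e
  | Ax, Ay, Au | Ax, Au, Ay => Cst (- 2^-1)
  | Ax, Ay, Av | Ax, Av, Ay => Cst 2^-1 * u
  | Ay, Ay, Ay => Cst 2 * e
  | Ay, Ay, Av | Ay, Av, Ay => Cst 2^-1
  | Au, Ax, Ay | Au, Ay, Ax => Cst 4 * e * e
  | Au, Ax, Av | Au, Av, Ax => Cst 2 * e
  | Au, Ay, Ay => Cst (-8) * u * e * e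
  | Au, Ay, Au | Au, Au, Ay => - e
  | Au, Ay, Av | Au, Av, Ay => Cst (-2) * u * e
  | Au, Au, Av | Au, Av, Au => Cst (- 2^-1)
  | Av, Ay, Ay => Cst (-4) * e * e
  | Av, Ay, Av | Av, Av, Ay => e
  | _, _, _ => 0
  end%T.

Definition M6N_gradient (k : axis) : term R :=
  match k with
  | Ax => Cst 2 * u * Jet [:: Au] + Cst 2 * Jet [:: Av]
  | Ay => Cst 2 * Jet [:: Au]
  | Au => Cst 2 * u * Jet [:: Ax] + Cst 2 * Jet [:: Ay] - Cst 4 * e * Jet [:: Av]
  | Av => Cst 2 * Jet [:: Ax] - Cst 4 * e * Jet [:: Au]
  end%T.

(** Consequences of the system, named by the derivative that they
    determine.  The xv-component serves to eliminate [phi] from the others. *)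
Definition M6N_uv : term R := (Jet [:: Au; Av] + Cst 2^-1 * Jet [:: Au])%T.
Definition M6N_vv : term R := (Jet [:: Av; Av] - Cst 4^-1 * Jet [::])%T.
Definition M6N_xy : term R := (Jet [:: Ax; Ay] + Cst 2 * e * Jet [:: Ax]
    - Cst 2 * e * Jet [:: Ax; Av])%T.
Definition M6N_yu : term R := (Jet [:: Ay; Au] + Cst 2^-1 * Jet [:: Ax]
    + Cst 3 * e * Jet [:: Au] - Jet [:: Ax; Av])%T.
Definition M6N_xv : term R := (Jet [:: Ax; Av] - Cst 2^-1 * Jet [:: Ax])%T.
Definition M6N_xy' : term R := (Jet [:: Ax; Ay] + e * Jet [:: Ax])%T.
Definition M6N_yv : term R := (Jet [:: Ay; Av] - Cst 2^-1 * Jet [:: Ay]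
    - e * Jet [:: Av] - Cst 2^-1 * e * Jet [::])%T.
Definition M6N_yy : term R := (Jet [:: Ay; Ay] - Cst 2 * e * Jet [:: Ay]
    + Cst 4 * e * e * Jet [:: Av] - Cst 13 * e * e * Jet [::])%T.
Definition M6N_v : term R := (Jet [:: Av] + Cst 2^-1 * Jet [::])%T.

Local Ltac at_point :=
  cbv [M6N_metric M6N_symbols M6N_gradient M6N_uv M6N_vv M6N_xy M6N_yu M6N_xv
    M6N_xy' M6N_yv M6N_yy M6N_v];
  eval_terms; abstract_point; try move: (expR _) => ?; by field.

Lemma M6N_connection U s :
  table_connection U s (tensor (M6N R)) M6N_metric M6N_symbols.
Proof.
split=> [p _|p a b _|a b|c a b|p a b _|p c a b _|p m a b _].
- exact: M6N_signature.
- case: a b => -[]; metric_entry; by at_point.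
- by case: a b => -[].
- by case: c a b => -[] [].
- by case: a b => -[].
- by case: c a b => -[] [].
- case: m a b => -[] []; by at_point.
Qed.

(** Each of [s_u], [s_x], [s_v + s/2], [s_y] is found to vanish by computing a
    mixed derivative in two ways; the displayed linear combinations of
    equations are chosen so that the derivatives of higher order cancel. *)
Lemma M6N_nowhere : nowhere_einstein_representative (M6N R).
Proof.
move=> U oU [p0 Up0] UD [s es]; have [ss s0 _] := es.
have [||phi H] := @einstein_hessian R (M6N R) U s M6N_metric M6N_symbols
  M6N_gradient oU es (M6N_connection U s).
- by move=> p [].
- by move=> p a Up; case: a; at_point.
have D a t : (forall p, defined s t p) -> vanishes U s t -> vanishes U s (diff a t).
  by move=> dt; apply: (vanishes_diff oU ss) => p _; exact: dt.
have phiE p : U p -> phi p = 2 * jet s [:: Ax; Av] p - 4 * eval s e p * jet s [:: Au] p.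
  move=> Up; apply/eqP; rewrite -subr_eq0; apply/eqP.
  apply: (@eq0_of_eq R (-2) _ _ _ (H p Ax Av Up)).
  by move: (phi p) => f; at_point.
have uv : vanishes U s M6N_uv.
  move=> p Up; apply: (@eq0_of_eq R 1 _ _ _ (H p Au Av Up)).
  by move: (phi p) => f; at_point.
have vv : vanishes U s M6N_vv.
  move=> p Up; apply: (@eq0_of_eq R 1 _ _ _ (H p Av Av Up)).
  rewrite -[s p]/(jet s [::] p).
  by move: (phi p) => f; at_point.
have xy : vanishes U s M6N_xy.
  move=> p Up; apply: (@eq0_of_eq R 1 _ _ _ (H p Ax Ay Up)).
  by rewrite phiE //; at_point.
have yu : vanishes U s M6N_yu.
  move=> p Up; apply: (@eq0_of_eq R 1 _ _ _ (H p Ay Au Up)).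
  by rewrite phiE //; at_point.
have eN0 p : eval s e p != 0 by rewrite /= gt_eqF // expR_gt0.
(* Equate the two expressions for s_yuv. *)
have su : vanishes U s (Jet [:: Au]).
  move=> p Up; apply: (mulfI (mulf_neq0 (_ : 6 != 0 :> R) (eN0 p))).
    by rewrite pnatr_eq0.
  rewrite mulr0.
  transitivity (eval s (diff Av M6N_yu) p
    - eval s (diff Ay M6N_uv) p
    + eval s (diff Ax M6N_vv) p
    + 2^-1 * eval s M6N_yu p
    - 3 * eval s e p * eval s M6N_uv p).
    by at_point.
  by rewrite (D _ _ _ yu) // (D _ _ _ uv) // (D _ _ _ vv) // yu // uv //; ring.
have xv : vanishes U s M6N_xv.
  move=> p Up; move: (yu p Up) (su p Up) (D Ay (Jet [:: Au]) (fun _ => I) su p Up).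
  cbv [M6N_yu M6N_xv]; eval_terms => h h1 h2; rewrite h1 h2 in h.
  by rewrite -[RHS]oppr0 -h; ring.
have xy' : vanishes U s M6N_xy'.
  move=> p Up; rewrite -[RHS](xy p Up).
  transitivity (eval s M6N_xy p
    + 2 * eval s e p * eval s M6N_xv p).
    by at_point.
  by rewrite xv // mulr0 addr0.
(* Equate the two expressions for s_xyv. *)
have sx : vanishes U s (Jet [:: Ax]).
  move=> p Up; apply: (mulfI (mulf_neq0 (_ : 2 != 0 :> R) (eN0 p))).
    by rewrite pnatr_eq0.
  rewrite mulr0.
  transitivity (eval s (diff Av M6N_xy') p
    - eval s (diff Ay M6N_xv) p
    - eval s e p * eval s M6N_xv p
    - 2^-1 * eval s M6N_xy' p).
    by at_point.
  by rewrite (D _ _ _ xy') // (D _ _ _ xv) // xv // xy' //; ring.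
have phi0 p : U p -> phi p = 0.
  move=> Up; rewrite phiE //.
  move: (su p Up) (D Av (Jet [:: Ax]) (fun _ => I) sx p Up).
  by eval_terms => -> ->; ring.
have yv : vanishes U s M6N_yv.
  move=> p Up; apply: (@eq0_of_eq R 1 _ _ _ (H p Ay Av Up)).
  rewrite phi0 // -[s p]/(jet s [::] p); move: (sx p Up) (su p Up).
  by cbv [M6N_metric M6N_symbols M6N_yv M6N_yy]; eval_terms => -> ->; at_point.
have yy : vanishes U s M6N_yy.
  move=> p Up; apply: (@eq0_of_eq R 1 _ _ _ (H p Ay Ay Up)).
  rewrite phi0 // -[s p]/(jet s [::] p); move: (sx p Up) (su p Up).
  by cbv [M6N_metric M6N_symbols M6N_yv M6N_yy]; eval_terms => -> ->; at_point.
(* Equate the two expressions for s_yvv. *)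
have sv : vanishes U s M6N_v.
  move=> p Up; apply: (mulfI (mulf_neq0 (_ : - 3 != 0 :> R) (eN0 p))).
    by rewrite oppr_eq0 pnatr_eq0.
  rewrite mulr0.
  transitivity (eval s (diff Av M6N_yv) p
    - eval s (diff Ay M6N_vv) p
    + 2^-1 * eval s M6N_yv p
    + eval s e p * eval s M6N_vv p).
    by at_point.
  by rewrite (D _ _ _ yv) // (D _ _ _ vv) // yv // vv //; ring.
have sy : vanishes U s (Jet [:: Ay]).
  move=> p Up.
  transitivity (eval s (diff Ay M6N_v) p
    - eval s M6N_yv p
    - eval s e p * eval s M6N_v p).
    by at_point.
  by rewrite (D _ _ _ sv) // yv // sv //; ring.
(* The yy-component has become -15 e^2 s = 0. *)
have /eqP := s0 p0 Up0; apply.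
apply: (mulfI (mulf_neq0 (mulf_neq0 (_ : - 15 != 0 :> R) (eN0 p0)) (eN0 p0))).
  by rewrite oppr_eq0 pnatr_eq0.
rewrite mulr0 -[s p0]/(jet s [::] p0).
transitivity (eval s M6N_yy p0
  - eval s (diff Ay (Jet [:: Ay])) p0
  + 2 * eval s e p0 * eval s (Jet [:: Ay]) p0
  - 4 * eval s e p0 * eval s e p0
    * eval s M6N_v p0).
  by at_point.
by rewrite yy // (D _ _ _ sy) // sy // sv //; ring.
Qed.

End M6N.

Theorem theorem5p9 (R : realType) :
  [/\ admits_einstein_representative (M9 R),
      admits_einstein_representative (M8_1 R) /\
        admits_einstein_representative (M8_2 R),
      (forall r eps : R, 0 <= r -> eps = 1 \/ eps = -1 ->
         admits_einstein_representative (M7 r eps)),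
      (forall kappa eps : R,
         [\/ kappa = 1 /\ eps = -1, kappa = -1 /\ eps = 1
           | kappa = 1 /\ eps = 1] ->
         nowhere_einstein_representative (M6S kappa eps))
    & nowhere_einstein_representative (M6N R)].
Proof.
split.
- exact: M9_einstein.
- by split; [exact: M8_1_einstein|exact: M8_2_einstein].
- by move=> r eps _ epsE; exact: M7_einstein.
- move=> kappa eps [] [-> ->]; apply: M6S_nowhere; rewrite ?oppr_eq0 ?oner_neq0 //;
    by [left|right].
- exact: M6N_nowhere.
Qed.
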